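(* Let $k$ be a positive integer and let $(G,x,y)$ be a $2$-connected rooted graph. Suppose that $\deg_G(v)\ge 2k-1$ for every $v\in V(G)\setminus\{x,y\}$. Then $G$ contains $k$ paths from $x$ to $y$ satisfying the length condition or the semi-length condition.
   Context: All graphs are finite and simple. For distinct vertices $x,y$ of a graph $G$, $(G,x,y)$ is a rooted graph. A rooted graph $(G,x,y)$ is $2$-connected if (R1) $G$ is a connected graph of order at least $3$ with at most two end blocks, and (R2) every end block of $G$ contains at least one of $x$ and $y$ as a non-cut vertex (equivalently, $G$ plus the edge $xy$ is $2$-connected). A sequence of paths $H_1,\dots,H_k$ satisfies the length condition if $|E(H_1)|\ge 2$ and $|E(H_{i+1})|-|E(H_i)|=2$ for $1\le i\le k-1$. It satisfies the semi-length condition if $|E(H_1)|\ge 2$ and there is an index $j$ with $1\le j\le k-1$ (a switch) such that $|E(H_{i+1})|-|E(H_i)|=2$ for $1\le i\le j-1$, $|E(H_{j+1})|-|E(H_j)|=1$, and $|E(H_{i+1})|-|E(H_i)|=2$ for $j+1\le i\le k-1$. *)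

(* Defs.v *)
From HB Require Import structures.
From mathcomp Require Import all_boot.

Set Implicit Arguments.
Unset Strict Implicit.
Unset Printing Implicit Defensive.

(* A finite simple graph is a symmetric irreflexive relation on a finType;
   its induced subgraphs are given by their vertex sets. *)
Section Graphs.

Variables (T : finType) (e : rel T).

Definition simple_graph : Prop := symmetric e /\ irreflexive e.

Definition degree (v : T) : nat := #|[set w | e v w]|.

Definition induced (A : {set T}) : rel T :=
  [rel u v | [&& u \in A, v \in A & e u v]].

Definition connected_in (A : {set T}) : bool :=
  (A != set0) && [forall u in A, forall v in A, connect (induced A) u v].

(* Deleting v increases the number of components of the induced subgraph on A,
   i.e. it separates two vertices of one component. *)
Definition cut_vertex_in (A : {set T}) (v : T) : bool :=
  (v \in A) &&
  [exists u in A :\ v, exists w in A :\ v,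
     connect (induced A) u w && ~~ connect (induced (A :\ v)) u w].

Definition cut_vertex (v : T) : bool := cut_vertex_in [set: T] v.

(* A block is a maximal connected subgraph having no cut vertex of its own.
   Adding edges between vertices of such a subgraph creates no cut vertex, so
   blocks are induced subgraphs and are represented by their vertex sets. *)
Definition block (B : {set T}) : bool :=
  maxset [pred A : {set T} |
            connected_in A && [forall v, ~~ cut_vertex_in A v]] B.

(* With "at most one", a connected graph without cut vertices is its own unique
   end block. *)
Definition end_block (B : {set T}) : bool :=
  block B && (#|[set v in B | cut_vertex v]| <= 1).

Definition rooted_2connected (x y : T) : Prop :=
  [/\ connected_in [set: T],
      3 <= #|T|,
      #|[set B | end_block B]| <= 2
    & forall B, end_block B ->
        (x \in B) && ~~ cut_vertex x || (y \in B) && ~~ cut_vertex y].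

(* The path with vertex sequence x :: p; it has size p edges. *)
Definition path_from_to (x y : T) (p : seq T) : bool :=
  [&& path e x p, last x p == y & uniq (x :: p)].

End Graphs.

(* Both conditions are on the sequence of lengths (numbers of edges) of the
   paths. Indices start at 0, so the gap numbered i is between the (i+1)-st and
   the (i+2)-nd path. *)
Definition length_condition (l : seq nat) : Prop :=
  2 <= nth 0 l 0 /\
  (forall i, i.+1 < size l -> nth 0 l i.+1 = nth 0 l i + 2).

Definition semi_length_condition (l : seq nat) : Prop :=
  2 <= nth 0 l 0 /\
  exists2 j, j.+1 < size l &
    forall i, i.+1 < size l ->
      nth 0 l i.+1 = nth 0 l i + (if i == j then 1 else 2).

(* Main.v *)
Require Import Defs.
From mathcomp Require Import all_boot zify.

Set Implicit Arguments.
Unset Strict Implicit.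
Unset Printing Implicit Defensive.

(* A rooted graph is contracted over and over, so it is encoded without its
   roots: (A, F, G) stands for the graph on A plus two roots x and y, where F and
   G are the neighbourhoods of x and y; the edge xy plays no role.  Contracting a
   set to a root only changes F or G, and the relation e never changes.

   The statement proved by induction on |A| is stronger in two ways: one vertex
   z of A may have arbitrary degree, and degree at least d, for any d, yields
   path lengths that contain either (d + 1)/2 terms with difference 2 or d - 1
   consecutive integers.  A set Z of vertices having, besides one root, a single
   vertex in its boundary is itself a smaller rooted graph, so the graph may be
   supposed to have no such 2-cut.  Then:
   - if x lies in a triangle, contract a maximum clique of N(x).  Each outer
     vertex loses at most m - 1 in degree, where m is the size of the clique, and
     the clique offers paths of all the lengths 1, ..., m;
   - if x lies in no triangle but in a 4-cycle x t1 w t2, delete w and contract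
     {t1, t2}.  The degrees drop by at most 2 and the 4-cycle offers paths of
     length 1 and 3.  If the resulting graph is not 2-connected, there is a pocket
     attached to x, w and another vertex, in which w plays the role of z;
   - otherwise contract N(x), which costs nothing.
   The component of y in the contracted graph may be too small.  In that case the
   same construction from y succeeds, or the neighbourhoods of x and y coincide
   and some component of the rest is used with two roots inside them. *)

(** * Sequences of lengths *)

(* The truncated subtractions leave one term in both cases when d <= 2. *)
Definition spread (d : nat) (L : nat -> Prop) : Prop :=
  exists a, (forall i, i.*2 <= d.-1 -> L (a + i.*2))
         \/ (forall i, i <= d - 2 -> L (a + i)).

Lemma spread_shift d c (L L' : nat -> Prop) :
  (forall n, L n -> L' (n + c)) -> spread d L -> spread d L'.
Proof.
move=> LL' [a [H|H]]; exists (a + c); [left|right] => i /H /LL'; by rewrite addnAC.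
Qed.

(** For l > 0 the offsets 0, ..., l fill the gaps of a progression with difference 2, so both forms
    of [spread (d - l)] become consecutive integers. This serves contractions that cost l in degree
    and offer l + 1 consecutive detours. *)
Lemma spread_interval d l c (L L' : nat -> Prop) :
  (forall n j, L n -> j <= l -> L' (n + j + c)) ->
  spread (d - l) L -> spread d L'.
Proof.
move=> LL'; case: l LL' => [|l] LL'.
  rewrite subn0; apply: (@spread_shift _ c) => n Ln; have := LL' n 0 Ln isT.
  by rewrite addn0.
case=> a [] H; exists (a + c); right => i le_i.
  (* The largest offset of the progression not exceeding i. The rest of i is at most [l.+1], as the
     last offset is at least d - l - 3. *)
  have Hm : (minn i./2 (d - l.+1).-1./2).*2 <= (d - l.+1).-1 by lia.
  have := LL' _ (i - (minn i./2 (d - l.+1).-1./2).*2) (H _ Hm).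
  suff Hj : i - (minn i./2 (d - l.+1).-1./2).*2 <= l.+1.
    move=> /(_ Hj); congr L'; lia.
  lia.
have Hm : minn i (d - l.+1 - 2) <= d - l.+1 - 2 by lia.
have := LL' _ (i - minn i (d - l.+1 - 2)) (H _ Hm).
suff Hj : i - minn i (d - l.+1 - 2) <= l.+1.
  move=> /(_ Hj); congr L'; lia.
lia.
Qed.

(** A progression with difference 2 gains one term from n + 3, as required for two more units of d.
    For consecutive integers and d > 4, the shifts by 1 and by 3 leave no gap between them. *)
Lemma spread_two d (L L' : nat -> Prop) : 2 < d ->
  (forall n, L n -> L' n.+1 /\ L' n.+3) -> spread (d - 2) L -> spread d L'.
Proof.
move=> d3 LL' [a [] H]; exists a.+1.
  left => i le_i; case: (leqP i.*2 (d - 2).-1) => [/H/LL'[]//|lt_i].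
  have le_i1 : i.-1.*2 <= (d - 2).-1 by lia.
  have [_] := LL' _ (H _ le_i1); congr L'; lia.
(* For d = 3 or 4 only one length n is guaranteed, and n + 1, n + 3 are not consecutive; but two
   terms with difference 2 suffice. *)
case: (leqP d 4) => d4.
  have [L1 L3] := LL' _ (H 0 isT).
  left => -[|[|i]] le_i; last by lia.
    by move: L1; congr L'; lia.
  by move: L3; congr L'; lia.
right => i le_i; case: (leqP i (d - 2 - 2)) => [/H/LL'[]//|lt_i].
have le_i2 : i - 2 <= d - 2 - 2 by lia.
have [_] := LL' _ (H _ le_i2); congr L'; lia.
Qed.

(** With d = 2k - 1 the progression has k terms and gives the length condition; the 2k - 2
    consecutive integers give the semi-length condition. [m.+1] turns a number of inner vertices
    into a number of edges. *)
Lemma spread_lengths k (L : nat -> Prop) : 0 < k ->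
  (forall n, L n -> 0 < n) -> spread (2 * k - 1) L ->
  exists l : seq nat,
    [/\ size l = k, (forall n, n \in l -> exists2 m, L m & n = m.+1)
      & length_condition l \/ semi_length_condition l].
Proof.
move=> k0 L0 [a [] H].
  exists (mkseq (fun i => (a + i.*2).+1) k); split.
  - by rewrite size_mkseq.
  - move=> n /mapP[i]; rewrite mem_iota => lt_i ->; exists (a + i.*2) => //.
    by apply: H; lia.
  left; split.
    by rewrite nth_mkseq // !ltnS; apply/L0/H; lia.
  move=> i; rewrite size_mkseq => lt_i; rewrite !nth_mkseq; lia.
have [-> | k1] : k = 1 \/ 1 < k by lia.
  exists [:: a.+1]; split=> //.
    by move=> n; rewrite inE => /eqP->; exists a => //; rewrite -[a]addn0; apply: H.
  by left; split=> //=; rewrite ltnS; apply: L0; rewrite -[a]addn0; apply: H.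
(* All gaps are 2 except the last, which is 1: the largest integer available is a + 2k - 3, one
   short of a further gap of 2. Counted from 0, the switch is k - 2. *)
pose f i := if i == k.-1 then a + i.*2 else (a + i.*2).+1.
exists (mkseq f k); split.
- by rewrite size_mkseq.
- move=> n /mapP[i]; rewrite mem_iota /f => lt_i ->.
  case: eqP => [->|ne_i].
    by exists (a + k.-1.*2.-1); [apply: H; lia | lia].
  by exists (a + i.*2); [apply: H; lia | lia].
right; split.
  rewrite nth_mkseq // /f ifF; last by lia.
  by rewrite ltnS; apply/L0/H; lia.
exists (k - 2); first by rewrite size_mkseq; lia.
move=> i; rewrite size_mkseq => lt_i; rewrite !nth_mkseq; [|lia|lia].
rewrite /f; case: eqP; case: eqP; case: eqP => /=; lia.
Qed.

(** * Trails and reachability *)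

Section RootedGraph.

Variables (V : finType) (e : rel V).
Hypotheses (e_sym : symmetric e) (e_irr : irreflexive e).

Implicit Types (A B F G Z T : {set V}) (u v w q : V).

Definition nbr v : {set V} := [set u | e v u].
Definition nbrs T : {set V} := [set u | [exists t in T, e t u]].

(* n is the number of vertices, one less than the length of the path from x to y. *)
Definition trail A F G (n : nat) : Prop :=
  exists h t, [/\ n = (size t).+1, path e h t, uniq (h :: t),
    {subset h :: t <= A} & (h \in F) && (last h t \in G)].

Lemma in_nbrs T u v : u \in T -> e u v -> v \in nbrs T.
Proof. by move=> uT euv; rewrite inE; apply/existsP; exists u; rewrite uT. Qed.

Lemma nbrsP T v : reflect (exists2 u, u \in T & e u v) (v \in nbrs T).
Proof.
rewrite inE; apply: (iffP existsP) => [[u /andP[uT euv]]|[u uT euv]].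
  by exists u.
by exists u; rewrite uT.
Qed.

Lemma trail_gt0 A F G n : trail A F G n -> 0 < n.
Proof. by case=> h [t [->]]. Qed.

Lemma trail_sub A B F F' G G' n : A \subset B ->
  {in A, forall v, v \in F -> v \in F'} -> {in A, forall v, v \in G -> v \in G'} ->
  trail A F G n -> trail B F' G' n.
Proof.
move=> /subsetP sAB sF sG [h [t [-> p_t u_t sub /andP[hF lG]]]].
exists h, t; split=> //; first by move=> v /sub/sAB.
by rewrite sF ?sG // sub ?mem_last ?mem_head.
Qed.

Lemma trailW A B F G n : A \subset B -> trail A F G n -> trail B F G n.
Proof. by move=> sAB; apply: trail_sub. Qed.

Lemma trail1 A F G v : v \in A -> v \in F -> v \in G -> trail A F G 1.
Proof.
move=> vA vF vG; exists v, [::]; split=> //; last by rewrite vF.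
by move=> u; rewrite inE => /eqP->.
Qed.

Lemma trail_rev A F G n : trail A F G n -> trail A G F n.
Proof.
move=> [h [t [-> p_t u_t sub /andP[hF lG]]]].
exists (last h t), (rev (belast h t)).
have E : last h t :: rev (belast h t) = rev (h :: t).
  by rewrite [in RHS]lastI rev_rcons.
split.
- by rewrite size_rev size_belast.
- rewrite rev_path; apply: sub_path p_t => a b /=; by rewrite e_sym.
- by rewrite E rev_uniq.
- by move=> v; rewrite E mem_rev; apply: sub.
rewrite lG /=; case: t {p_t u_t sub E lG} => //= a t.
by rewrite rev_cons last_rcons.
Qed.

Lemma trail_cat A1 A2 A F G t n1 n2 :
  A1 \subset A -> A2 \subset A -> [disjoint A1 & A2] ->
  trail A1 F [set t] n1 -> trail A2 (nbr t) G n2 -> trail A F G (n1 + n2).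
Proof.
move=> /subsetP s1 /subsetP s2 dis [h1 [p1 [-> path1 u1 sub1 /andP[hF]]]].
rewrite inE => /eqP l1 [h2 [p2 [-> path2 u2 sub2 /andP[]]]].
rewrite inE => th lG.
exists h1, (p1 ++ h2 :: p2); split.
- by rewrite size_cat /= addSn.
- by rewrite cat_path path1 l1 /= th.
- rewrite -cat_cons cat_uniq u1 u2 andbT andTb; apply/hasPn => v /sub2 vA2.
  apply/negP => /sub1 vA1; by rewrite (disjointFr dis vA1) in vA2.
- move=> v; rewrite -cat_cons mem_cat => /orP[/sub1/s1|/sub2/s2] //.
by rewrite hF last_cat /=.
Qed.

Lemma trail_catr A1 A2 A F G t n1 n2 :
  A1 \subset A -> A2 \subset A -> [disjoint A1 & A2] ->
  trail A1 F (nbr t) n1 -> trail A2 [set t] G n2 -> trail A F G (n1 + n2).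
Proof.
move=> s1 s2 dis /trail_rev tr1 /trail_rev tr2; apply: trail_rev; rewrite addnC.
by apply: trail_cat tr2 tr1; rewrite // disjoint_sym.
Qed.

Lemma trail_from_nbrs A T G n :
  trail A (nbrs T) G n -> exists2 t, t \in T & trail A (nbr t) G n.
Proof.
move=> [h [t [-> p_t u_t sub /andP[/nbrsP[a aT ea] lG]]]].
by exists a => //; exists h, t; split=> //; rewrite inE ea.
Qed.

Lemma trail_to_nbrs A F T n :
  trail A F (nbrs T) n -> exists2 t, t \in T & trail A F (nbr t) n.
Proof.
by move=> /trail_rev/trail_from_nbrs[t tT tr]; exists t => //; apply: trail_rev.
Qed.

Definition closed_in A Z : Prop :=
  forall u v, u \in Z -> v \in A -> e u v -> v \in Z.

(** The component of the root y, without y, when G is the neighbourhood of y. After a contraction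
    only this component is kept. *)
Definition reach A G : {set V} :=
  [set v in A | [exists g in A :&: G, connect (induced e A) g v]].

Lemma reachP A G v :
  reflect (v \in A /\ exists g, [/\ g \in A, g \in G & connect (induced e A) g v])
    (v \in reach A G).
Proof.
rewrite inE; apply: (iffP andP) => -[vA].
  by move=> /existsP[g /andP[/setIP[gA gG] c]]; split=> //; exists g.
by case=> g [gA gG c]; split=> //; apply/existsP; exists g; rewrite inE gA gG.
Qed.

Lemma reach_sub A G : reach A G \subset A.
Proof. by apply/subsetP => v /reachP[]. Qed.

Lemma reach_closed A G : closed_in A (reach A G).
Proof.
move=> u v /reachP[uA [g [gA gG c]]] vA euv; apply/reachP; split=> //.
exists g; split=> //; apply: connect_trans c _; apply: connect1.
by rewrite /induced /= uA vA.
Qed.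

Lemma reach_base A G v : v \in A -> v \in G -> v \in reach A G.
Proof. by move=> vA vG; apply/reachP; split=> //; exists v. Qed.

Lemma induced_sym A : connect_sym (induced e A).
Proof.
by apply: sym_connect_sym => u v; rewrite /induced /= e_sym andbCA.
Qed.

Lemma closed_in_connect A Z u v :
  closed_in A Z -> u \in Z -> connect (induced e A) u v -> v \in Z.
Proof.
move=> clZ uZ /connectP[p]; elim: p u uZ => [|a p IHp] u uZ /=; first by move=> _ ->.
by case/andP=> /and3P[_ aA eua] /(IHp a); apply; apply: clZ eua.
Qed.

(** A walk from z back to G stays in the closed set Z, so no closed part of the component of y
    avoids the neighbours of y. *)
Lemma reach_meet A G Z z : Z \subset reach A G -> z \in Z -> closed_in A Z ->
  exists2 g, g \in Z & g \in G.
Proof.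
move=> /subsetP sub zZ clZ; have /reachP[_ [g [gA gG]]] := sub z zZ.
by rewrite induced_sym => /(closed_in_connect clZ zZ); exists g.
Qed.

Lemma reach_trail A F v : v \in reach A F -> exists n, trail A F [set v] n.
Proof.
case/reachP=> vA [g [gA gF /connectP[p]]].
case/shortenP=> p' path' uniq' _ ->.
exists (size p').+1, g, p'; split=> //.
- by apply: sub_path path' => a b /and3P[].
- move=> a; rewrite inE => /orP[/eqP->//|].
  elim: p' g {gA gF uniq'} path' => //= b p' IHp g /andP[/and3P[_ bA _] pb].
  by rewrite inE => /orP[/eqP->//|]; apply: IHp pb.
by rewrite gF inE eqxx.
Qed.

(** The hypothesis is applied to the set of all vertices reached from F, which is closed. The
    existence of a path thus reduces to the absence of a cut. *)
Lemma trail_exists A F G u : u \in A -> u \in F ->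
  (forall Z, Z \subset A -> u \in Z -> closed_in A Z ->
     exists2 v, v \in Z & v \in G) ->
  exists n, trail A F G n.
Proof.
move=> uA uF H.
have [v vR vG] := H _ (reach_sub A F) (reach_base uA uF) (@reach_closed A F).
have [n tr] := reach_trail vR; exists n.
by apply: trail_sub tr => // w _; rewrite inE => /eqP->.
Qed.

End RootedGraph.

(** * Two-connectivity *)

Section Linked.

Variables (V : finType) (e : rel V).
Hypotheses (e_sym : symmetric e) (e_irr : irreflexive e).

Implicit Types (A B F G Z T Q : {set V}) (u v w q z : V).

Local Notation nbr := (nbr e).
Local Notation nbrs := (nbrs e).
Local Notation trail := (trail e).

Definition boundary_in A Z Q : bool :=
  [forall u in Z, forall v in A, e u v ==> (v \in Z :|: Q)].

Lemma bdP A Z Q :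
  reflect (forall u v, u \in Z -> v \in A -> e u v -> v \in Z \/ v \in Q) (boundary_in A Z Q).
Proof.
apply: (iffP forall_inP) => [H u v uZ vA euv|H u uZ].
  by have /forall_inP/(_ v vA)/implyP/(_ euv) := H u uZ; rewrite inE => /orP.
by apply/forall_inP => v vA; apply/implyP => euv; rewrite inE; apply/orP/(H u).
Qed.

Lemma bd1P A Z q :
  reflect (forall u v, u \in Z -> v \in A -> e u v -> v \in Z \/ v = q) (boundary_in A Z [set q]).
Proof.
by apply: (iffP (bdP _ _ _)) => H u v uZ vA euv;
  have [vZ|vq] := H u v uZ vA euv; [left|right; apply/set1P|left|right; apply/set1P].
Qed.

Lemma bd0P A Z : reflect (closed_in e A Z) (boundary_in A Z set0).
Proof.
apply: (iffP (bdP _ _ _)) => H u v uZ vA euv; first by have [//|] := H u v uZ vA euv; rewrite inE.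
by left; apply: H euv.
Qed.

Lemma disjP Z F : reflect (forall u, u \in Z -> u \notin F) [disjoint Z & F].
Proof.
apply: (iffP idP) => [dis u uZ|H]; first by rewrite (disjointFr dis uZ).
by rewrite disjoint_subset; apply/subsetP => u /H.
Qed.

Lemma meetP Z F : reflect (exists2 u, u \in Z & u \in F) (~~ [disjoint Z & F]).
Proof.
rewrite disjoints_subset; apply: (iffP subsetPn) => -[u uZ uF]; exists u => //.
  by move: uF; rewrite inE negbK.
by rewrite inE negbK.
Qed.

Definition deg A F G v : nat := #|A :&: nbr v| + (v \in F) + (v \in G).

Lemma card_nbr_le A B Q v :
  (forall u, u \in A -> e v u -> u \in B \/ u \in Q) ->
  #|A :&: nbr v| <= #|B :&: nbr v| + #|Q :&: nbr v|.
Proof.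
move=> H; apply: leq_trans (leq_card_setU _ _); apply/subset_leq_card/subsetP => u.
rewrite !inE => /andP[uA evu]; rewrite evu !andbT.
by have [->|->] := H u uA evu; rewrite ?orbT.
Qed.

Lemma card_nbr1 v w : #|[set w] :&: nbr v| = e v w.
Proof.
case E: (e v w); last first.
  by apply/eqP; rewrite cards_eq0 -subset0; apply/subsetP => u; rewrite !inE;
     case: eqP => [->|]; rewrite ?E.
by rewrite -[nat_of_bool true]/1 -(cards1 w); congr #|pred_of_set _|; apply/setIidPl; rewrite sub1set inE.
Qed.

Lemma card_nbr1_le A B w v :
  (forall u, u \in A -> e v u -> u \in B \/ u = w) ->
  #|A :&: nbr v| <= #|B :&: nbr v| + e v w.
Proof.
rewrite -(card_nbr1 v w) => H; apply: card_nbr_le => u uA evu.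
by have [->|->] := H u uA evu; [left|right; rewrite inE].
Qed.

Lemma card_nbr0_le A B v :
  (forall u, u \in A -> e v u -> u \in B) -> #|A :&: nbr v| <= #|B :&: nbr v|.
Proof.
move=> H; apply/subset_leq_card/subsetP => u; rewrite !inE => /andP[uA evu].
by rewrite evu H.
Qed.

(* The graph with the edge xy added is 2-connected: a nonempty set of non-roots
   has two vertices in its boundary, x counting when it meets F and y when it
   meets G. *)
Definition linked A F G : Prop :=
  forall Z z, Z \subset A -> z \in Z ->
  [/\ forall q, [disjoint Z & F] -> [disjoint Z & G] -> ~~ boundary_in A Z [set q],
      [disjoint Z & F] -> ~~ boundary_in A Z set0
    & [disjoint Z & G] -> ~~ boundary_in A Z set0].

Lemma linkedC A F G : linked A F G -> linked A G F.
Proof. by move=> lk Z z sZ zZ; have [H1 H2 H3] := lk Z z sZ zZ; split; auto. Qed.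

(** z may lie outside A, and then no vertex is exceptional. Some vertex other than z must exist, as
    otherwise no degree is controlled. *)
Definition solvable_upto n : Prop :=
  forall A F G z d, #|A| <= n -> linked A F G ->
  (forall v, v \in A -> v != z -> d <= deg A F G v) ->
  (exists2 v, v \in A & v != z) -> spread d (trail A F G).

(** Besides x only w is attached to Z, so w takes over the role of y. A subset that avoids [nbr w]
    has the same boundary in A as in Z. *)
Lemma linked_cut A F G Z w : linked A F G -> Z \subset A -> w \notin Z ->
  boundary_in A Z [set w] -> [disjoint Z & G] -> linked Z F (nbr w).
Proof.
move=> lk sZ wZ /bd1P bdZ /disjP ZG Z1 z s1 z1.
have s1A := subset_trans s1 sZ; have [H1 H2 H3] := lk Z1 z s1A z1.
have sub u : u \in Z1 -> u \in Z by apply/subsetP.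
have Z1G : [disjoint Z1 & G] by apply/disjP => u /sub/ZG.
split.
- move=> q d1 /disjP d2; apply: contra (H1 q d1 Z1G) => /bd1P bd1.
  apply/bd1P => u v u1 vA euv; have [vZ|vw] := bdZ u v (sub u u1) vA euv.
    exact: bd1 euv.
  by have /negP[] := d2 u u1; rewrite inE e_sym -vw.
- move=> d1; apply: contra (H1 w d1 Z1G) => /bd0P bd1.
  apply/bd1P => u v u1 vA euv; have [vZ|->] := bdZ u v (sub u u1) vA euv; last by right.
  by left; apply: bd1 euv.
- move=> /disjP d2; apply: contra (H3 Z1G) => /bd0P bd1.
  apply/bd0P => u v u1 vA euv; have [vZ|vw] := bdZ u v (sub u u1) vA euv.
    exact: bd1 euv.
  by have /negP[] := d2 u u1; rewrite inE e_sym -vw.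
Qed.

Lemma linked_closed A F G Z : linked A F G -> Z \subset A -> boundary_in A Z set0 ->
  linked Z F G.
Proof.
move=> lk sZ /bd0P bdZ Z1 z s1 z1.
have s1A := subset_trans s1 sZ; have [H1 H2 H3] := lk Z1 z s1A z1.
have sub u : u \in Z1 -> u \in Z by apply/subsetP.
split.
- move=> q d1 d2; apply: contra (H1 q d1 d2) => /bd1P bd1.
  by apply/bd1P => u v u1 vA euv; apply: (bd1 u) => //; apply: (bdZ u); rewrite ?sub.
- move=> d1; apply: contra (H2 d1) => /bd0P bd1.
  by apply/bd0P => u v u1 vA euv; apply: (bd1 u) => //; apply: (bdZ u); rewrite ?sub.
- move=> d1; apply: contra (H3 d1) => /bd0P bd1.
  by apply/bd0P => u v u1 vA euv; apply: (bd1 u) => //; apply: (bdZ u); rewrite ?sub.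
Qed.

Section Step.

Variables (n : nat).
Hypothesis IH : solvable_upto n.

(** A fixed path from w to y outside Z extends all the paths that induction finds from x to w
    through Z. Degrees in Z do not drop, since an edge to w becomes an edge to a root. *)
Lemma spread_cut A F G Z w z d : #|A| <= n.+1 -> linked A F G ->
  Z \subset A -> w \in A -> w \notin Z -> boundary_in A Z [set w] -> [disjoint Z & G] ->
  (forall v, v \in Z -> v != z -> d <= deg A F G v) ->
  (exists2 v, v \in Z & v != z) -> spread d (trail A F G).
Proof.
move=> An lk sZ wA wZ bdZ ZG degZ [v0 v0Z v0z].
have ltZ : #|Z| <= n.
  rewrite -ltnS; apply: leq_trans An; apply/proper_card/properP; split=> //.
  by exists w.
have [m tr] : exists m, trail (A :\: Z) [set w] G m.
  apply: (@trail_exists _ _ _ _ _ w); first by rewrite inE wZ.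
    by rewrite inE.
  (* If W missed G, then Z together with W would be cut off from y. *)
  move=> W sW wW clW; apply/meetP/negP => WG.
  have sU : Z :|: W \subset A by rewrite subUset sZ (subset_trans sW) ?subsetDl.
  have [|_ _ H3] := lk _ w sU; first by rewrite inE wW orbT.
  move: H3 => /(_ _)/negP[]; first by apply/disjP => u; rewrite inE => /orP[/(disjP _ _ ZG)|/(disjP _ _ WG)].
  apply/bd0P => u v; rewrite !inE => /orP[uZ|uW] vA euv.
    by have [->//|->] := bd1P _ _ _ bdZ u v uZ vA euv; rewrite wW orbT.
  case: (boolP (v \in Z)) => //= vZ; apply: clW uW _ euv.
  by rewrite inE vZ.
apply: (@spread_shift d m (trail Z F (nbr w))).
  move=> k trk; apply: (trail_catr e_sym sZ (subsetDl A Z) _ trk tr).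
  by apply/disjP => u uZ; rewrite inE uZ.
apply: (@IH _ _ _ z d ltZ (linked_cut lk sZ wZ bdZ ZG)); last by exists v0.
move=> v vZ vz; apply: leq_trans (degZ v vZ vz) _.
rewrite /deg (negbTE (disjP _ _ ZG v vZ)) addn0 [v \in nbr w]inE e_sym.
rewrite addnAC leq_add2r; apply: card_nbr1_le => u uA evu.
exact: (bd1P _ _ _ bdZ) evu.
Qed.

Lemma spread_closed A F G Z z d : #|A| <= n.+1 -> linked A F G ->
  Z \subset A -> Z != A -> boundary_in A Z set0 ->
  (forall v, v \in Z -> v != z -> d <= deg A F G v) ->
  (exists2 v, v \in Z & v != z) -> spread d (trail A F G).
Proof.
move=> An lk sZ ZA bdZ degZ exZ.
have ltZ : #|Z| <= n.
  by rewrite -ltnS; apply: leq_trans An; apply/proper_card; rewrite properEneq ZA.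
apply: (@spread_shift d 0 (trail Z F G)).
  by move=> k; rewrite addn0; apply: trailW.
apply: IH ltZ (linked_closed lk sZ bdZ) _ exZ => v vZ vz.
apply: leq_trans (degZ v vZ vz) _; rewrite /deg !leq_add2r.
by apply: card_nbr0_le => u uA evu; apply: (bd0P _ _ bdZ) evu.
Qed.

End Step.
End Linked.

(** * Two-cuts and pockets *)

Lemma three_bits d (a b c : bool) : 2 < d -> d <= a + b + c ->
  [/\ a, b, c & d = 3].
Proof. by case: a b c d => [] [] [] [|[|[|[|d]]]]. Qed.

Section Reductions.

Variables (V : finType) (e : rel V).
Hypotheses (e_sym : symmetric e) (e_irr : irreflexive e).

Implicit Types (A B F G Z T Q : {set V}) (u v w q z : V).

Local Notation nbr := (nbr e).
Local Notation nbrs := (nbrs e).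
Local Notation trail := (trail e).
Local Notation boundary_in := (boundary_in e).
Local Notation deg := (deg e).
Local Notation linked := (linked e).

Lemma bd_set1 A Z q : boundary_in A Z [set q] -> q \notin A :\: Z -> boundary_in A Z set0.
Proof.
move=> /bd1P H qAZ; apply/bd0P => u v uZ vA euv.
by have [//|vq] := H u v uZ vA euv; move: qAZ; rewrite -vq inE vA andbT negbK.
Qed.

Lemma bd_sub A Z Q Q' : Q \subset Q' -> boundary_in A Z Q -> boundary_in A Z Q'.
Proof.
move=> /subsetP sQ /bdP H; apply/bdP => u v uZ vA euv.
by have [|/sQ] := H u v uZ vA euv; auto.
Qed.

Lemma linkedVn A F G : linked A F G \/
  exists Z z, [/\ Z \subset A, z \in Z &
    [\/ exists q, [/\ [disjoint Z & F], [disjoint Z & G] & boundary_in A Z [set q]],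
        [disjoint Z & F] /\ boundary_in A Z set0 | [disjoint Z & G] /\ boundary_in A Z set0]].
Proof.
case: (boolP [exists Z : {set V}, [exists z, [&& Z \subset A, z \in Z &
    [|| [exists q, [&& [disjoint Z & F], [disjoint Z & G] & boundary_in A Z [set q]]],
        [disjoint Z & F] && boundary_in A Z set0 | [disjoint Z & G] && boundary_in A Z set0]]]]).
  case/existsP=> Z /existsP[z /and3P[sZ zZ /or3P H]]; right; exists Z, z; split=> //.
  case: H => [/existsP[q /and3P[]]|/andP[]|/andP[]]; last 2 first.
  - by constructor 2.
  - by constructor 3.
  by constructor 1; exists q.
rewrite negb_exists => /forallP H; left => Z z sZ zZ.
have := H Z; rewrite negb_exists => /forallP/(_ z); rewrite sZ zZ /= !negb_or.
case/and3P=> H1 H2 H3; split.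
- move=> q d1 d2; move: H1; rewrite negb_exists => /forallP/(_ q).
  by rewrite d1 d2.
- by move=> d1; rewrite d1 in H2.
by move=> d1; rewrite d1 in H3.
Qed.

(* No 2-cut contains x or y. *)
Definition linked3 A F G : Prop :=
  forall Z z, Z \subset A -> z \in Z ->
  [/\ forall q, boundary_in A Z [set q] -> exists2 u, u \in Z & u \in F,
      forall q, boundary_in A Z [set q] -> exists2 u, u \in Z & u \in G
    & boundary_in A Z set0 -> Z = A].

Lemma linked3C A F G : linked3 A F G -> linked3 A G F.
Proof. by move=> lk Z z sZ zZ; have [] := lk Z z sZ zZ. Qed.

Variables (n : nat).
Hypothesis IH : solvable_upto e n.

(** The exceptional vertex z has no neighbours but possibly x and q. It is deleted, and q, the only
    vertex of A whose degree may drop, becomes exceptional. *)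
Lemma spread_removable A F G q z d : 2 < d -> #|A| <= n.+1 -> linked A F G ->
  (forall v, v \in A -> v != z -> d <= deg A F G v) ->
  (exists2 v, v \in A & v != z) -> z \in A -> q \in A -> q != z ->
  z \notin G -> boundary_in A [set z] [set q] -> spread d (trail A F G).
Proof.
move=> d3 An lk degA [v0 v0A v0z] zA qA qz zG /bd1P bdz.
have z_q v : v \in A -> v != q -> e v z = false.
  move=> vA vq; apply/negP; rewrite e_sym => ezv.
  have [//|/set1P vz|vq'] := bdz z v _ vA ezv; first by rewrite inE.
    by rewrite vz e_irr in ezv.
  by rewrite vq' eqxx in vq.
have ltA1 : #|A :\ z| <= n by move: An; rewrite (cardsD1 z) zA.
case: (boolP [exists v in A :\ z, v != q]) => [/exists_inP ex1|/exists_inPn none].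
  case: (linkedVn (A :\ z) F G) => [lk1|[Z1 [z1 [s1 z1Z fail]]]].
    apply: (@spread_shift _ 0 (trail (A :\ z) F G)).
      by move=> k; rewrite addn0; apply: trailW; apply: subsetDl.
    apply: (@IH _ _ _ q d ltA1 lk1 _ ex1) => v /setD1P[vz vA] vq.
    apply: leq_trans (degA v vA vz) _; rewrite !leq_add2r.
    apply: card_nbr0_le => u uA evu; rewrite !inE uA andbT.
    by apply/eqP => uz; rewrite uz z_q in evu.
  have s1A := subset_trans s1 (subsetDl A _); have s1' := subsetP s1.
  have lift Q : q \notin Z1 -> boundary_in (A :\ z) Z1 Q -> boundary_in A Z1 Q.
    move=> qZ /bdP bd1; apply/bdP => u v uZ vA euv.
    have [uz uA] := setD1P (s1' u uZ).
    case: (eqVneq v z) => [vz|vz]; last by apply: bd1 uZ _ euv; rewrite !inE vz.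
    by rewrite vz z_q // in euv; apply: contraNneq qZ => <-.
  have [H1 H2 H3] := lk _ _ s1A z1Z.
  (* A forbidden set without q is not adjacent to z and was forbidden before the deletion. A set
     with q is enlarged by z. *)
  case: (boolP (q \in Z1)) => [qZ|qZ]; last first.
    case: fail => [[q1 [d1 d2 b1]]|[d1 b1]|[d1 b1]]; exfalso.
    - by have /negP[] := H1 q1 d1 d2; apply: lift.
    - by have /negP[] := H2 d1; apply: lift.
    - by have /negP[] := H3 d1; apply: lift.
  have liftU Q : boundary_in (A :\ z) Z1 Q -> boundary_in A (z |: Z1) Q.
    move=> /bdP bd1; apply/bdP => u v; rewrite !inE => /orP[/eqP->|uZ] vA euv.
      have [|/set1P->|->] := bdz z v _ vA euv; rewrite ?inE ?eqxx ?qZ ?orbT //; by left.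
    case: (eqVneq v z) => [_|vz]; first by left.
    by apply: bd1 uZ _ euv; rewrite !inE vz.
  have sU : z |: Z1 \subset A by rewrite subUset sub1set zA.
  have dU : [disjoint Z1 & G] -> [disjoint z |: Z1 & G].
    move=> /disjP d1; apply/disjP => u; rewrite !inE => /orP[/eqP->//|]; exact: d1.
  have zU : z \in z |: Z1 by rewrite setU11.
  have exU : exists2 v, v \in z |: Z1 & v != z by exists q => //; rewrite inE qZ orbT.
  have [_ _ H3U] := lk _ _ sU zU.
  case: fail => [[q1 [d1 d2 /liftU b1]]|[d1 b1]|[d1 /liftU b1]].
  - case: (boolP (q1 \in A :\: (z |: Z1))) => [/setDP[q1A q1Z]|q1Z].
      apply: (spread_cut e_sym IH An lk sU q1A q1Z b1 (dU d2) _ exU) => v vZ.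
      by apply: degA; apply: (subsetP sU).
    by have /negP[] := H3U (dU d2); apply: bd_set1 b1 q1Z.
  (* If [z |: Z1] is everything, z alone attaches Z1 to the side of x, and the roots are
     exchanged. *)
  - case: (eqVneq (z |: Z1) A) => [EA|neA]; last first.
      apply: (spread_closed IH An lk sU neA (liftU _ b1) _ exU) => v vZ.
      by apply: degA; apply: (subsetP sU).
    have zZ1 : z \notin Z1 by apply/negP => /s1'; rewrite !inE eqxx.
    suff : spread d (trail A G F).
      by apply: (@spread_shift _ 0) => k; rewrite addn0; apply: trail_rev.
    apply: (@spread_cut _ _ e_sym _ IH _ _ _ Z1 z z) => //.
    + exact: linkedC.
    + apply/bd1P => u v uZ vA euv; move: vA; rewrite -EA => /setU1P[]; by [right|left].
    + move=> v vZ vz; rewrite /deg addnAC; apply: degA vz.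
      by apply: (subsetP s1A).
    by exists q.
  by have /negP[] := H3U (dU d1).
(* Only z and q are left. The degree of q forces d = 3 and makes q adjacent to z, x and y; the
   trails are q and z, q. *)
have vq v : v \in A -> v != z -> v = q.
  by move=> vA vz; apply/eqP; have := none v; rewrite !inE vz negbK; apply.
have [|H1 _ _] := lk [set z] z _ (set11 z); first by rewrite sub1set.
have zF : z \in F.
  apply/negPn/negP => zF; have /negP[] : ~~ boundary_in A [set z] [set q]; last exact/bd1P.
  by apply: H1; apply/disjP => u /set1P->.
have card1 : #|A :&: nbr q| <= e q z.
  rewrite -card_nbr1; apply/subset_leq_card/subsetP => u; rewrite !inE => /andP[uA equ].
  rewrite equ andbT; apply/negPn/negP => uz; have uq := vq u uA uz.
  by rewrite uq e_irr in equ.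
have := degA q qA qz; rewrite /deg => degq.
have [eqz qF qG d_eq] : [/\ e q z, q \in F, q \in G & d = 3].
  by apply: three_bits d3 (leq_trans degq _); rewrite !leq_add2r.
exists 1; right => -[_|[_|i]]; last by rewrite d_eq.
  exact: trail1 qF qG.
apply: (@trail_cat _ _ [set z] [set q] _ _ _ z 1 1); rewrite ?sub1set //.
- by apply/disjP => u /set1P->; rewrite inE eq_sym.
- by apply: trail1; rewrite ?inE.
by apply: trail1; rewrite ?inE // e_sym.
Qed.

(** Together with x, the vertex q is a 2-cut. If nothing but the exceptional vertex lies behind it,
    induction on Z is void, and z is removed instead. *)
Lemma spread_one_sided A F G Z q z0 z d : 2 < d -> #|A| <= n.+1 -> linked A F G ->
  (forall v, v \in A -> v != z -> d <= deg A F G v) ->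
  (exists2 v, v \in A & v != z) -> Z \subset A -> z0 \in Z ->
  [disjoint Z & G] -> boundary_in A Z [set q] -> spread d (trail A F G).
Proof.
move=> d3 An lk degA exA sZ z0Z ZG bdZ.
case: (boolP (q \in A :\: Z)) => [/setDP[qA qZ]|qZ]; last first.
  have [_ _ H3] := lk _ _ sZ z0Z.
  by have /negP[] := H3 ZG; apply: bd_set1 bdZ qZ.
have degZ v : v \in Z -> v != z -> d <= deg A F G v by move/(subsetP sZ)/degA.
case: (boolP [exists v in Z, v != z]) => [/exists_inP exZ|/exists_inPn none].
  exact: (spread_cut e_sym IH An lk sZ qA qZ bdZ ZG degZ exZ).
have Ez v : v \in Z -> v = z by move/none/negPn/eqP.
have zZ : z \in Z by rewrite -(Ez z0).
have EZ : Z = [set z].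
  by apply/setP => u; rewrite inE; apply/idP/eqP => [/Ez|->].
apply: (@spread_removable A F G q z) => //.
- exact: (subsetP sZ).
- by apply: contraNneq qZ => ->.
- exact: (disjP _ _ ZG).
by rewrite -EZ.
Qed.

Lemma spread_or_linked3 A F G z d : 2 < d -> #|A| <= n.+1 -> linked A F G ->
  (forall v, v \in A -> v != z -> d <= deg A F G v) ->
  (exists2 v, v \in A & v != z) -> spread d (trail A F G) \/ linked3 A F G.
Proof.
move=> d3 An lk degA exA.
case: (boolP [exists Z : {set V}, [exists z0, [&& Z \subset A, z0 \in Z &
    ((Z != A) && boundary_in A Z set0) || [exists q,
      boundary_in A Z [set q] && ([disjoint Z & F] || [disjoint Z & G])]]]]); last first.
  rewrite negb_exists => /forallP H; right => Z z0 sZ z0Z.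
  have := H Z; rewrite negb_exists => /forallP/(_ z0); rewrite sZ z0Z /= negb_or.
  case/andP=> H1; rewrite negb_exists => /forallP H2.
  split=> [q bdq|q bdq|bd0].
  - by apply/meetP; have := H2 q; rewrite bdq negb_or => /andP[].
  - by apply/meetP; have := H2 q; rewrite bdq negb_or => /andP[].
  by apply/eqP; move: H1; rewrite bd0 andbT negbK.
case/existsP=> Z /existsP[z0 /and3P[sZ z0Z]]; left; move: p => /orP[/andP[ZA bd0]|].
  have degZ v : v \in Z -> v != z -> d <= deg A F G v by move/(subsetP sZ)/degA.
  case: (boolP [exists v in Z, v != z]) => [/exists_inP exZ|/exists_inPn none].
    exact: (spread_closed IH An lk sZ ZA bd0 degZ exZ).
  have Ez v : v \in Z -> v = z by move/none/negPn/eqP.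
  (* The complement of a closed set is closed, and here it contains the vertices other than z. *)
  have [v vA vz] := exA.
  apply: (@spread_closed _ _ _ IH A F G (A :\: Z) z) => //.
  - exact: subsetDl.
  - by apply/eqP => /setP/(_ z0); rewrite inE z0Z (subsetP sZ).
  - apply/bd0P => a b /setDP[aA aZ] bA eab; rewrite inE bA andbT.
    by apply: contra aZ => bZ; apply: (bd0P _ _ _ bd0) bZ aA _; rewrite e_sym.
  - by move=> u /setDP[uA _]; apply: degA.
  by exists v => //; rewrite inE vA andbT; apply: contra vz => /Ez->.
case/existsP=> q /andP[bdq /orP[dF|dG]]; last exact: (spread_one_sided d3 An lk degA exA sZ z0Z dG bdq).
suff : spread d (trail A G F).
  by apply: (@spread_shift _ 0) => k; rewrite addn0; apply: trail_rev.
apply: (spread_one_sided d3 An (linkedC lk) _ exA sZ z0Z dF bdq) => v vA vz.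
by rewrite /deg addnAC; apply: degA.
Qed.

(* Exceptional vertices are needed because of this situation: w is the
   attachment of B to the part of the graph left behind, and its degree in
   w |: B is out of control. *)
Lemma spread_pocket B F G w d : 2 < d -> #|B| < n -> w \notin B ->
  linked B (nbr w) G -> B != set0 ->
  (forall v, v \in B -> d <= #|B :&: nbr v| + (v \in nbr w) + (v \in F) + (v \in G)) ->
  [\/ spread d (trail (w |: B) F G), spread d (trail B (nbr w) G)
    | exists q, [/\ B = [set q], d <= 3, q \in F, e w q & q \in G]].
Proof.
move=> d3 Bn wB lk /set0Pn[b0 b0B] degB.
have Bn1 : #|B| <= n.+1 by lia.
have neq_w v : v \in B -> v != w by apply: contraTneq => ->.
(* A bad set contains no neighbour of x, so its vertices keep degree d when the roots are w and y.
   Without bad sets the roots x and y are used, and w is kept or dropped. *)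
pose bad (Z : {set V}) := [&& Z \subset B, Z != set0, [disjoint Z & F] &
  boundary_in B Z set0 || [exists q, [disjoint Z & G] && boundary_in B Z [set q]]].
case: (boolP [exists Z, bad Z]) => [/existsP[Z /and4P[sZ /set0Pn[z zZ] dF]]|].
  have degZ v : v \in Z -> v != w -> d <= deg B (nbr w) G v.
    move=> vZ _; have := degB v (subsetP sZ v vZ).
    by rewrite (negbTE (disjP _ _ dF v vZ)) addn0.
  have exZ : exists2 v, v \in Z & v != w by exists z => //; apply/neq_w/(subsetP sZ).
  move=> H; constructor 2; case/orP: H => [bd0|/existsP[q /andP[dG bdq]]].
    case: (eqVneq Z B) => [EZ|ZB]; last exact: (spread_closed IH Bn1 lk sZ ZB bd0 degZ exZ).
    by apply: (IH (ltnW Bn) lk (z := w)); rewrite -EZ // => v vZ vw; rewrite EZ; apply: degZ.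
  case: (boolP (q \in B :\: Z)) => [/setDP[qB qZ]|qZ].
    exact: (spread_cut e_sym IH Bn1 lk sZ qB qZ bdq dG degZ exZ).
  have [_ _ H3] := lk _ _ sZ zZ; have /negP[] := H3 dG; exact: bd_set1 bdq qZ.
rewrite negb_exists => /forallP good.
have good0 Z z : Z \subset B -> z \in Z -> [disjoint Z & F] -> ~~ boundary_in B Z set0.
  move=> sZ zZ dF; have := good Z; rewrite /bad sZ dF /= negb_and negbK.
  case/orP=> [/eqP Z0|]; first by rewrite Z0 inE in zZ.
  by rewrite negb_or => /andP[].
have good1 Z z q : Z \subset B -> z \in Z -> [disjoint Z & F] -> [disjoint Z & G] ->
    ~~ boundary_in B Z [set q].
  move=> sZ zZ dF dG; have := good Z; rewrite /bad sZ dF /= negb_and negbK.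
  case/orP=> [/eqP Z0|]; first by rewrite Z0 inE in zZ.
  by rewrite negb_or negb_exists => /andP[_ /forallP/(_ q)]; rewrite dG.
have [_ _ HB] := lk B b0 (subxx _) b0B.
have bdBB Q : boundary_in B B Q by apply/bdP => u v _ vB _; left.
(* If w is adjacent to no root and to at most one vertex b of B, then {w} violates [linked]. It is
   dropped, and b becomes exceptional. *)
case: (boolP [exists b, [&& w \notin F, w \notin G & B :&: nbr w \subset [set b]]]).
  case/existsP=> b /and3P[wF wG /subsetP sub].
  have w_b v : v \in B -> e w v -> v = b.
    by move=> vB ewv; apply/set1P/sub; rewrite !inE vB.
  case: (boolP [exists v in B, v != b]) => [/exists_inP exB|/exists_inPn none].
    constructor 1; apply: (@spread_shift _ 0 (trail B F G)).
      by move=> k; rewrite addn0; apply: trailW; apply: subsetUr.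
    apply: (@IH B F G b) => //; first exact: ltnW.
      move=> Z z sZ zZ; have [_ _ H3] := lk Z z sZ zZ; split=> //; last exact: good0 zZ.
      by move=> q; apply: good1 zZ.
    move=> v vB vb; have := degB v vB.
    suff -> : (v \in nbr w) = false by rewrite addn0.
    by apply/negP; rewrite inE => /w_b E; rewrite E ?eqxx in vb.
  have Eb v : v \in B -> v = b by move/none/negPn/eqP.
  have bB : b \in B by rewrite -(Eb b0).
  have EB : B = [set b] by apply/setP => v; rewrite inE; apply/idP/eqP => [/Eb|->].
  constructor 3; exists b; have := degB b bB.
  have -> : #|B :&: nbr b| = 0.
    apply/eqP; rewrite cards_eq0 -subset0; apply/subsetP => v; rewrite !inE.
    by case/andP=> /Eb->; rewrite e_irr.
  by rewrite inE => /(three_bits d3)[ewb bF bG ->].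
rewrite negb_exists => /forallP wide; constructor 1.
have [q /setIP[qB qw]] : exists q, q \in B :&: nbr w.
  apply/set0Pn; apply/negP => /eqP E; have [_ H2 _] := lk B b0 (subxx _) b0B.
  suff /H2 : [disjoint B & nbr w] by rewrite bdBB.
  by rewrite -setI_eq0 E.
have eqw : e q w by rewrite e_sym; move: qw; rewrite inE.
apply: (@IH (w |: B) F G w) => //.
- by rewrite cardsU1 wB.
- move=> Z z sZ zZ.
  case: (boolP (Z \subset [set w])) => [Zw|/subsetPn[z2 z2Z /set1P z2w]].
    have Ez : z = w by apply/set1P/(subsetP Zw).
    have wZ : w \in Z by rewrite -Ez.
    have qZ : q \notin Z by apply/negP => /(subsetP Zw)/set1P E; have := neq_w q qB; rewrite E eqxx.
    have no0 : ~~ boundary_in (w |: B) Z set0.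
      apply/negP => /bd0P/(_ w q wZ); rewrite in_setU1 qB orbT (negbTE qZ) e_sym.
      by move/(_ isT eqw).
    split=> // b /disjP dF /disjP dG; apply/negP => /bd1P bdb.
    have := wide b; rewrite dF // dG //= => /subsetPn[u /setIP[uB uw] /set1P ub].
    have ewu : e w u by move: uw; rewrite inE.
    have [|uZ|//] := bdb w u wZ _ ewu.
      by rewrite in_setU1 uB orbT.
    by have /negP[] := neq_w u uB; rewrite (set1P (subsetP Zw _ uZ)).
  have s2 : Z :\ w \subset B by rewrite subDset.
  have z2Z' : z2 \in Z :\ w by rewrite !inE z2Z andbT; apply/eqP.
  have d2 (H : {set V}) : [disjoint Z & H] -> [disjoint Z :\ w & H].
    by move/disjP => dH; apply/disjP => u /setD1P[_]; apply: dH.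
  have bd2 Q : boundary_in (w |: B) Z Q -> boundary_in B (Z :\ w) Q.
    move=> /bdP bdZ; apply/bdP => u v /setD1P[_ uZ] vB euv.
    have [|vZ|vQ] := bdZ u v uZ _ euv; [by rewrite in_setU1 vB orbT| |by right].
    by left; rewrite in_setD1 vZ neq_w.
  split.
  + by move=> b /d2 dF /d2 dG; apply: contra (good1 _ _ b s2 z2Z' dF dG); apply: bd2.
  + by move=> /d2 dF; apply: contra (good0 _ _ s2 z2Z' dF); apply: bd2.
  move=> /d2 dG; have [_ _ H3] := lk _ _ s2 z2Z'.
  by apply: contra (H3 dG); apply: bd2.
- move=> v /setU1P[->|vB] vw; first by rewrite eqxx in vw.
  apply: leq_trans (degB v vB) _; rewrite /deg !leq_add2r inE.
  have -> : (w |: B) :&: nbr v = (B :&: nbr v) :|: ([set w] :&: nbr v).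
    by rewrite -setIUl setUC.
  have dis : (B :&: nbr v) :&: ([set w] :&: nbr v) = set0.
    apply/setP => u; rewrite !inE; case: eqP => [->|_]; first by rewrite (negbTE wB).
    by rewrite andbF.
  by rewrite cardsU dis cards0 subn0 card_nbr1 e_sym.
by exists q; [rewrite in_setU1 qB orbT | apply: neq_w].
Qed.

End Reductions.

(** * Contractions *)

Section Contractions.

Variables (V : finType) (e : rel V).
Hypotheses (e_sym : symmetric e) (e_irr : irreflexive e).

Implicit Types (A B F G Z T Q : {set V}) (u v w q z t : V).

Local Notation nbr := (nbr e).
Local Notation nbrs := (nbrs e).
Local Notation trail := (trail e).
Local Notation boundary_in := (boundary_in e).
Local Notation deg := (deg e).
Local Notation linked := (linked e).
Local Notation linked3 := (linked3 e).
Local Notation reach := (reach e).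

Lemma spreadC A F G d : spread d (trail A G F) -> spread d (trail A F G).
Proof. by apply: (@spread_shift _ 0) => k; rewrite addn0; apply: trail_rev. Qed.

Definition clique T : Prop := forall u v, u \in T -> v \in T -> u != v -> e u v.

Lemma clique_path T h s : clique T -> uniq (h :: s) -> {subset h :: s <= T} ->
  path e h s.
Proof.
move=> cl; elim: s h => //= a s IHs h /and3P[hs aS us] sub.
rewrite IHs ?aS ?andbT //=; last by move=> v vS; apply: sub; rewrite inE vS orbT.
apply: cl; rewrite ?sub ?inE ?eqxx ?orbT //.
by apply: contraNneq hs => ->; rewrite inE eqxx.
Qed.

Lemma clique_trail T F t j : clique T -> T \subset F -> t \in T ->
  0 < j <= #|T| -> trail T F [set t] j.
Proof.
move=> cl /subsetP sTF tT /andP[j0 jT]; apply: (trail_rev e_sym).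
pose s := take j.-1 (enum (T :\ t)).
have sT v : v \in s -> v \in T :\ t by move/mem_take; rewrite mem_enum.
have us : uniq (t :: s).
  rewrite /= take_uniq ?enum_uniq // andbT; apply/negP => /sT.
  by rewrite !inE eqxx.
have sub : {subset t :: s <= T}.
  by move=> v; rewrite inE => /orP[/eqP->//|/sT/setD1P[]].
exists t, s; split=> //; last first.
- by rewrite inE eqxx /= sTF // sub // mem_last.
- exact: clique_path us sub.
rewrite size_take -cardE; have := jT; rewrite (cardsD1 t) tT.
by case: ltnP; lia.
Qed.

Section Contract.

Variables (n : nat) (A : {set V}) (z : V) (d : nat).
Hypotheses (IH : solvable_upto e n) (d_gt2 : 2 < d) (An : #|A| <= n.+1).

Definition ready F G : Prop :=
  linked3 A F G /\ (forall v, v \in A -> v != z -> d <= deg A F G v).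

Lemma readyC F G : ready F G -> ready G F.
Proof.
case=> lk degA; split; first exact: linked3C.
by move=> v vA vz; rewrite /deg addnAC; apply: degA.
Qed.

(** A set that avoids [nbrs T] has the same boundary in A as in the component of y, so a cut of the
    contracted graph is a cut of A and is excluded by [linked3]. Closed sets in that component meet
    G by [reach_meet]. *)
Lemma linked_contract F G T t : linked3 A F G -> T \subset A -> t \in T ->
  linked (reach (A :\: T) G) (nbrs T) G.
Proof.
move=> lk sT tT Z z0 sZ z0Z; set A' := reach _ _ in sZ *.
have sA' : A' \subset A :\: T by apply: reach_sub.
have sZA : Z \subset A by apply: subset_trans sZ (subset_trans sA' (subsetDl _ _)).
have tA := subsetP sT t tT.
have lift Q : [disjoint Z & nbrs T] -> boundary_in A' Z Q -> boundary_in A Z Q.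
  move=> /disjP dT /bdP bdZ; apply/bdP => u v uZ vA euv.
  apply: (bdZ u v uZ _ euv); apply: (@reach_closed _ e _ _ u v _ _ euv).
    exact: (subsetP sZ).
  rewrite inE vA andbT; apply: contra (dT u uZ) => vT.
  by apply: in_nbrs vT _; rewrite e_sym.
have [_ H2 H3] := lk Z z0 sZA z0Z; split.
- move=> q dT dG; apply/negP => /(lift _ dT)/H2[u uZ].
  by rewrite (negbTE (disjP _ _ dG u uZ)).
- move=> dT; apply/negP => /(lift _ dT)/H3 EZ.
  have /(subsetP sZ)/(subsetP sA') : t \in Z by rewrite EZ.
  by rewrite inE tT.
move=> dG; apply/negP => /bd0P bdZ.
have [] := @reach_meet _ e e_sym (A :\: T) G Z z0 sZ z0Z.
  move=> u v uZ vA euv; apply: (bdZ u) => //.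
  exact: (@reach_closed _ e _ _ u _ (subsetP sZ u uZ) vA euv).
by move=> u uZ; rewrite (negbTE (disjP _ _ dG u uZ)).
Qed.

(** l bounds the net loss in degree: a vertex loses its neighbours in T and possibly x, and gains
    the new root if it is adjacent to T. *)
Lemma spread_contract F G T t l : ready F G -> T \subset A -> t \in T ->
  (forall v, v \in reach (A :\: T) G -> v != z ->
     #|T :&: nbr v| + (v \in F) <= l + (v \in nbrs T)) ->
  (exists2 v, v \in reach (A :\: T) G & v != z) ->
  spread (d - l) (trail (reach (A :\: T) G) (nbrs T) G).
Proof.
move=> [lk degA] sT tT loss exA'; set A' := reach _ _ in loss exA' *.
have sA' : A' \subset A :\: T by apply: reach_sub.
apply: (@IH A' (nbrs T) G z) => //.
- rewrite -ltnS; apply: leq_trans An; apply: proper_card; apply/properP; split.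
    exact: subset_trans sA' (subsetDl _ _).
  exists t; first exact: (subsetP sT).
  by apply/negP => /(subsetP sA'); rewrite inE tT.
- exact: linked_contract lk sT tT.
move=> v vA' vz; have /setDP[vA vT] := subsetP sA' v vA'.
have := degA v vA vz; have := loss v vA' vz; rewrite /deg.
suff : #|A :&: nbr v| <= #|A' :&: nbr v| + #|T :&: nbr v| by clear; lia.
apply: card_nbr_le => u uA evu; case: (boolP (u \in T)) => uT; [by right|left].
by apply: reach_closed vA' _ evu; rewrite inE uT.
Qed.

(** Since T is maximal, a vertex loses at most |T| edges to x and T together, and a vertex adjacent
    to T regains the new root: the net loss is at most |T| - 1. The clique offers initial segments
    with 1, ..., |T| vertices. *)
Lemma spread_clique F G T : ready F G -> T \subset A -> T \subset F ->
  clique T -> 1 < #|T| ->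
  (forall v, v \in A -> v \in F -> (forall t, t \in T -> e v t) -> False) ->
  (exists2 v, v \in reach (A :\: T) G & v != z) -> spread d (trail A F G).
Proof.
move=> rd sT sTF cl T1 maxT exA'.
have [t tT] : exists t, t \in T by apply/set0Pn; rewrite -card_gt0; lia.
apply: (@spread_interval d #|T|.-1 1 (trail (reach (A :\: T) G) (nbrs T) G)); last first.
  apply: (spread_contract rd sT tT _ exA') => v vA' vz.
  have /setDP[vA vT] := subsetP (reach_sub _ _ _) v vA'.
  case: (boolP (v \in nbrs T)) => [_|vnT]; last first.
    suff -> : T :&: nbr v = set0.
      by rewrite cards0 add0n addn0; apply: leq_trans (leq_b1 _) _; rewrite -ltnS prednK // ltnW.
    apply/setP => u; rewrite !inE; apply/negP => /andP[uT evu].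
    by case/negP: vnT; apply: in_nbrs uT _; rewrite e_sym.
  have leT : #|T :&: nbr v| <= #|T| by apply: subset_leq_card (subsetIl _ _).
  case: (boolP (v \in F)) => vF; last by rewrite addn0 addn1 prednK // ltnW.
  rewrite leq_add2r -ltnS prednK; last exact: ltnW.
  apply: proper_card; rewrite properEneq subsetIl andbT; apply/eqP => E.
  apply: (maxT v vA vF) => u; rewrite -E inE => /andP[_]; by rewrite inE.
move=> k j /trail_from_nbrs[t' t'T tr] jT.
rewrite -addnA addnC addn1; apply: (@trail_cat _ _ T (reach (A :\: T) G) _ _ _ t') => //.
- exact: subset_trans (reach_sub _ _ _) (subsetDl _ _).
- apply/disjP => u uT; apply/negP => /(subsetP (reach_sub _ _ _)).
  by rewrite inE uT.
by apply: clique_trail => //; lia.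
Qed.

(** A vertex has at most one neighbour in T, which the new root replaces, so no degree drops. *)
Lemma spread_star F G T t : ready F G -> T \subset A -> T \subset F -> t \in T ->
  (forall v, v \in A -> v \in F -> v \in T) ->
  (forall v t1 t2, v \in A -> t1 \in T -> t2 \in T -> e v t1 -> e v t2 -> t1 = t2) ->
  (exists2 v, v \in reach (A :\: T) G & v != z) -> spread d (trail A F G).
Proof.
move=> rd sT sTF tT allT one exA'.
apply: (@spread_shift d 1 (trail (reach (A :\: T) G) (nbrs T) G)).
  move=> k /trail_from_nbrs[t' t'T tr]; rewrite addnC.
  apply: (@trail_cat _ _ T (reach (A :\: T) G) _ _ _ t') => //.
  - exact: subset_trans (reach_sub _ _ _) (subsetDl _ _).
  - apply/disjP => u uT; apply/negP => /(subsetP (reach_sub _ _ _)).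
    by rewrite inE uT.
  by apply: trail1 (set11 _) => //; apply: (subsetP sTF).
rewrite -[d]subn0; apply: (spread_contract rd sT tT _ exA') => v vA' vz.
have /setDP[vA vT] := subsetP (reach_sub _ _ _) v vA'.
have -> : (v \in F) = false by apply: contraNF vT; apply: allT.
rewrite addn0 add0n; case: (boolP (v \in nbrs T)) => [_|vnT]; last first.
  rewrite leqn0 cards_eq0 -subset0; apply/subsetP => u; rewrite !inE => /andP[uT evu].
  by case/negP: vnT; apply: in_nbrs uT _; rewrite e_sym.
apply/card_le1P => a; rewrite !inE => /andP[aT eva] b; rewrite !inE.
by apply/idP/eqP => [/andP[bT evb]|->]; [apply: one evb eva | rewrite aT].
Qed.

(** * Components adjacent to neither root *)

Lemma reach_component T v0 Z z0 : v0 \in A :\: T ->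
  Z \subset reach (A :\: T) [set v0] -> z0 \in Z ->
  closed_in e (reach (A :\: T) [set v0]) Z -> Z = reach (A :\: T) [set v0].
Proof.
move=> v0A sZ z0Z clZ; apply/eqP; rewrite eqEsubset sZ; apply/subsetP => v vD.
have clZ' : closed_in e (A :\: T) Z.
  move=> a b aZ bA eab; apply: (clZ a) => //.
  by apply: (reach_closed _ bA eab); apply: (subsetP sZ).
have [v0' v0Z /set1P E] := reach_meet e_sym sZ z0Z clZ'; rewrite {}E in v0Z.
have /reachP[_ [g [gA /set1P -> c]]] := vD.
exact: closed_in_connect clZ' v0Z c.
Qed.

(** The component D of v0 is entered from t1 and left to another vertex t' of T, so its roots are t1
    and the contraction of the rest of T. A path runs from x inside T minus t' to t1, through D,
    then to t' and y. D is linked because a set with one boundary vertex would have to meet G, which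
    D avoids. *)
Lemma spread_twin_at F G T t1 v0 l : ready F G -> T \subset A -> t1 \in T ->
  T :\ t1 \subset G -> v0 \in A -> v0 \notin T -> v0 != z ->
  (forall v, v \in reach (A :\: T) [set v0] -> v \notin F /\ v \notin G) ->
  t1 \in nbrs (reach (A :\: T) [set v0]) ->
  (forall v, v \in A ->
     #|T :&: nbr v| <= l + e v t1 + (v \in nbrs (T :\ t1))) ->
  (forall t' j, t' \in T -> t1 != t' -> 0 < j <= l.+1 ->
     trail (T :\ t') F [set t1] j) ->
  spread d (trail A F G).
Proof.
move=> [lk degA] sT t1T sTG v0A v0T v0z; set D := reach _ _ => out t1D loss pref.
have sD : D \subset A :\: T by apply: reach_sub.
have sDA : D \subset A by apply: subset_trans sD (subsetDl _ _).
have v0AT : v0 \in A :\: T by rewrite inE v0T.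
have v0D : v0 \in D by apply: reach_base; rewrite ?inE // v0T.
have clD u v : u \in D -> v \in A -> e u v -> v \in D \/ v \in T.
  move=> uD vA euv; case: (boolP (v \in T)) => vT; [by right|left].
  by apply: reach_closed uD _ euv; rewrite inE vT.
have DG : [disjoint D & G] by apply/disjP => v /out[].
have lkD : linked D (nbr t1) (nbrs (T :\ t1)).
  move=> Z z0 sZ z0Z; have sZA := subset_trans sZ sDA.
  have sZ' := subsetP sZ.
  have meetsG q : boundary_in A Z [set q] -> False.
    have [_ H2 _] := lk Z z0 sZA z0Z.
    by move=> /H2[u /sZ' uD]; rewrite (negbTE (disjP _ _ DG u uD)).
  split.
  - move=> q /disjP d1 /disjP d2; apply/negP => /bd1P bdZ; apply: (meetsG q).
    apply/bd1P => u v uZ vA euv; have [vD|vT] := clD u v (sZ' u uZ) vA euv.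
      exact: bdZ uZ vD euv.
    exfalso; case: (eqVneq v t1) => [vt|vt].
      by have /negP[] := d1 u uZ; rewrite inE -vt e_sym.
    have /negP[] := d2 u uZ; apply: (@in_nbrs _ _ _ v); rewrite ?inE ?vt //.
    by rewrite e_sym.
  - move=> /disjP d1; apply/negP => /bd0P /(reach_component v0AT sZ z0Z) EZ.
    have /nbrsP[u uD eut] := t1D.
    by have := d1 u; rewrite EZ => /(_ uD); rewrite inE e_sym eut.
  move=> /disjP d2; apply/negP => /bd0P bdZ; apply: (meetsG t1).
  apply/bd1P => u v uZ vA euv; have [vD|vT] := clD u v (sZ' u uZ) vA euv.
    by left; apply: bdZ uZ vD euv.
  case: (eqVneq v t1) => [vt|vt]; first by right.
  have /negP[] := d2 u uZ; apply: (@in_nbrs _ _ _ v); rewrite ?inE ?vt //.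
  by rewrite e_sym.
have sprD : spread (d - l) (trail D (nbr t1) (nbrs (T :\ t1))).
  apply: (@IH _ _ _ z) => //.
  - rewrite -ltnS; apply: leq_trans An; apply: proper_card; apply/properP; split=> //.
    exists t1; first exact: (subsetP sT).
    by apply/negP => /(subsetP sD); rewrite inE t1T.
  - move=> v vD vz; have vA := subsetP sDA v vD.
    have := degA v vA vz; have := loss v vA; rewrite /deg.
    have [/negbTE-> /negbTE->] := out v vD.
    rewrite [v \in nbr t1]inE (e_sym t1).
    suff : #|A :&: nbr v| <= #|D :&: nbr v| + #|T :&: nbr v| by clear; lia.
    by apply: card_nbr_le => u uA evu; apply: clD evu.
  by exists v0.
apply: (@spread_interval d l 2 (trail D (nbr t1) (nbrs (T :\ t1))) _ _ sprD) => k j.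
move=> /(trail_to_nbrs e_sym)[t' /setD1P[t't1 t'T] tr] jl.
have tr1 : trail (D :|: (T :\ t')) F (nbr t') (j.+1 + k).
  apply: (@trail_cat _ _ (T :\ t') D _ _ _ t1) tr; rewrite ?subsetUl ?subsetUr //.
    apply/disjP => u /setD1P[_ uT]; apply/negP => /(subsetP sD).
    by rewrite inE uT.
  by apply: pref; rewrite // eq_sym.
rewrite (_ : k + j + 2 = j.+1 + k + 1); last by clear; lia.
apply: (@trail_catr _ _ e_sym (D :|: (T :\ t')) [set t'] A F G t' _ 1 _ _ _ tr1);
  rewrite ?sub1set ?(subsetP sT) //.
- by rewrite subUset sDA (subset_trans (subsetDl _ _)).
- apply/disjP => u /setUP[uD|/setD1P[ut' _]]; rewrite in_set1 //.
  by apply: contraTneq uD => ->; apply/negP => /(subsetP sD); rewrite inE t'T.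
apply: (@trail1 _ _ _ _ _ t'); rewrite ?in_set1 //; apply: (subsetP sTG).
by rewrite in_setD1 t't1.
Qed.

Lemma spread_twin F G T v0 l : ready F G -> T \subset A ->
  T \subset G -> v0 \in A -> v0 \notin T -> v0 != z ->
  (forall v, v \in reach (A :\: T) [set v0] -> v \notin F /\ v \notin G) ->
  (forall v t, v \in A -> t \in T ->
     #|T :&: nbr v| <= l + e v t + (v \in nbrs (T :\ t))) ->
  (forall t t' j, t \in T -> t' \in T -> t != t' -> 0 < j <= l.+1 ->
     trail (T :\ t') F [set t] j) ->
  spread d (trail A F G).
Proof.
move=> rd sT sTG v0A v0T v0z out loss pref; have [lk _] := rd.
set D := reach (A :\: T) [set v0].
have sDA : D \subset A by apply: subset_trans (reach_sub _ _ _) (subsetDl _ _).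
have v0D : v0 \in D by apply: reach_base; rewrite ?inE // v0T.
have [t1 t1T t1D] : exists2 t1, t1 \in T & t1 \in nbrs D.
  case: (boolP [exists t in T, t \in nbrs D]) => [/exists_inP//|/exists_inPn H].
  have [_ H2 _] := lk D v0 sDA v0D.
  have [|u uD] := H2 v0; last by have [_ /negbTE->] := out u uD.
  apply/bd1P => u v uD vA euv; case: (boolP (v \in T)) => vT.
    by have := H v vT; rewrite (in_nbrs uD euv).
  by left; apply: reach_closed uD _ euv; rewrite inE vT.
apply: (spread_twin_at rd sT t1T _ v0A v0T v0z out t1D).
- exact: subset_trans (subsetDl _ _) sTG.
- by move=> v vA; apply: loss.
- by move=> t' j; apply: pref.
Qed.

(* A vertex loses at most |T| - 2 of its degree when T minus t is contracted and
   t is kept. *)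
Lemma twin_loss T t v : t \in T -> 1 < #|T| ->
  #|T :&: nbr v| <= #|T| - 2 + e v t + (v \in nbrs (T :\ t)).
Proof.
move=> tT T2; rewrite (cardsD1 t) in_setI tT inE /= addnC addnAC leq_add2r.
have -> : (T :&: nbr v) :\ t = (T :\ t) :&: nbr v by rewrite setIDAC.
have := subset_leq_card (subsetIl (T :\ t) (nbr v)); have := cardsD1 t T; rewrite tT.
case: (boolP (v \in nbrs (T :\ t))) => vT; first by move: T2; clear; lia.
suff -> : (T :\ t) :&: nbr v = set0 by rewrite cards0.
apply/setP => u; rewrite in_set0 in_setI; apply/negP => /andP[uT].
rewrite inE => evu; case/negP: vT; apply: in_nbrs uT _; by rewrite e_sym.
Qed.

End Contract.
End Contractions.

(** * Four-cycles *)

Section Core.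

Variables (V : finType) (e : rel V).
Hypotheses (e_sym : symmetric e) (e_irr : irreflexive e).

Implicit Types (A B F G Z T Q : {set V}) (u v w q z t : V).

Local Notation nbr := (nbr e).
Local Notation nbrs := (nbrs e).
Local Notation trail := (trail e).
Local Notation boundary_in := (boundary_in e).
Local Notation deg := (deg e).
Local Notation linked := (linked e).
Local Notation linked3 := (linked3 e).
Local Notation reach := (reach e).

Variables (n : nat) (A : {set V}) (z : V) (d : nat).
Hypotheses (IH : solvable_upto e n) (d_gt2 : 2 < d) (An : #|A| <= n.+1).

Local Notation ready := (ready e A z d).

(* In a pocket, None stands for the root y. *)
Definition oset (c : option V) : {set V} := if c is Some c0 then [set c0] else set0.

Definition onbr G (c : option V) : {set V} := if c is Some c0 then nbr c0 else G.

(** The roots are w and c, with y in place of an absent c. A forbidden set would have at most one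
    boundary vertex in A, and [linked3] would make it meet G or fill A. *)
Lemma linked_pocket F G Z w c : linked3 A F G -> Z \subset A -> Z != A ->
  boundary_in A Z (w |: oset c) -> (c -> [disjoint Z & G]) -> linked Z (nbr w) (onbr G c).
Proof.
move=> lk sZ ZA /bdP bdZ Gc Z1 z1 s1 z1Z.
have sub u : u \in Z1 -> u \in Z by apply: (subsetP s1).
have s1A := subset_trans s1 sZ; have [_ H2 H3] := lk Z1 z1 s1A z1Z.
have Z1A : Z1 != A by apply: contraNneq ZA => E; rewrite eqEsubset sZ -{1}E.
have noG q : [disjoint Z1 & onbr G c] -> boundary_in A Z1 [set q] -> False.
  move=> /disjP dc /H2[u u1 uG]; case: c Gc dc {bdZ} => [c|] Gc dc; last first.
    by have := dc u u1; rewrite uG.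
  by have := disjP _ _ (Gc isT) u (sub u u1); rewrite uG.
have lift (Q : {set V}) : [disjoint Z1 & onbr G c] -> boundary_in Z Z1 Q -> boundary_in A Z1 (w |: Q).
  move=> /disjP dc /bdP bd1; apply/bdP => u v u1 vA euv.
  have [vZ|] := bdZ u v (sub u u1) vA euv.
    by have [|vQ] := bd1 u v u1 vZ euv; [left|right; rewrite in_setU1 vQ orbT].
  case/setU1P=> [->|vc]; first by right; rewrite setU11.
  case: c dc vc {bdZ Gc noG} => [c|] dc; rewrite ?inE // => /eqP E.
  by have := dc u u1; rewrite inE e_sym -E euv.
have nw (Q : {set V}) : [disjoint Z1 & nbr w] -> boundary_in A Z1 (w |: Q) -> boundary_in A Z1 Q.
  move=> /disjP dw /bdP bd1; apply/bdP => u v u1 vA euv.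
  have [v1|/setU1P[vw|vQ]] := bd1 u v u1 vA euv; [by left| |by right].
  by have := dw u u1; rewrite inE e_sym -vw euv.
split.
- by move=> q dw dc; apply/negP => bd1; apply: (noG q dc); apply: nw (lift _ dc bd1).
- move=> dw; apply/negP => /bd0P bd1.
  have : boundary_in A Z1 (oset c).
    apply: nw => //; apply/bdP => u v u1 vA euv.
    have [vZ|] := bdZ u v (sub u u1) vA euv; last by right.
    by left; apply: (bd1 u v u1).
  case: c Gc {bdZ noG lift} => [c|] Gc; last by move/H3/eqP; apply/negP.
  by move=> /H2[u u1 uG]; have := disjP _ _ (Gc isT) u (sub u u1); rewrite uG.
move=> dc; apply/negP => bd1; apply: (noG w dc); rewrite -[[set w]]setU0.
exact: lift.
Qed.

(** All neighbours of a vertex of Z lie in Z or among w, c and the roots, so no degree is lost. As z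
    is outside Z, w can be the exceptional vertex. *)
Lemma pocket_trichotomy F G Z z0 w c : ready F G -> Z \subset A -> #|Z| + 2 <= #|A| ->
  z0 \in Z -> w \notin Z -> z \notin Z ->
  boundary_in A Z (w |: oset c) -> (c -> [disjoint Z & G]) ->
  [\/ spread d (trail (w |: Z) F (onbr G c)), spread d (trail Z (nbr w) (onbr G c))
    | exists q, [/\ Z = [set q], d <= 3, q \in F, e w q & q \in onbr G c]].
Proof.
move=> [lk degA] sZ cardZ z0Z wZ zZ bdZ Gc.
have ZA : Z != A by apply/eqP => E; move: cardZ; rewrite E; clear; lia.
apply: (spread_pocket e_sym e_irr IH d_gt2 _ wZ).
- by move: cardZ An; clear; lia.
- exact: linked_pocket lk sZ ZA bdZ Gc.
- by apply/set0Pn; exists z0.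
move=> v vZ; have vz : v != z by apply: contraNneq zZ => <-.
have vA := subsetP sZ v vZ.
apply: leq_trans (degA v vA vz) _; rewrite /deg.
have -> : (v \in nbr w) = e v w by rewrite inE e_sym.
case: c bdZ Gc => [c|] /bdP bdZ Gc /=; last first.
  rewrite !leq_add2r; apply: card_nbr1_le => u uA evu.
  have [uZ|/setU1P[uw|]] := bdZ v u vZ uA evu; [by left|by right|by rewrite inE].
rewrite (negbTE (disjP _ _ (Gc isT) v vZ)) addn0.
have -> : (v \in nbr c) = e v c by rewrite inE e_sym.
rewrite addnAC leq_add2r -addnA -(card_nbr1 e v w) -(card_nbr1 e v c).
apply: (@leq_trans (#|Z :&: nbr v| + #|[set w; c] :&: nbr v|)).
  by apply: card_nbr_le => u uA evu; apply: bdZ evu.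
by rewrite leq_add2l setIUl; apply: leq_card_setU.
Qed.

(* The part of the graph reachable from the root y (attached at G) once the
   4-cycle x, t1, w, t2 is removed consists of c, the only possible neighbour of
   y in it, and of a pocket B hanging from c, w and x. *)
Definition dead_end F G w t1 t2 B c : Prop :=
  [/\ [/\ c \in A, c \in G, c \notin [set w; t1; t2] & e c t1 || e c t2],
      [/\ c \notin B, [disjoint B & G], [disjoint B & [set w; t1; t2]] & B \subset A],
      [/\ boundary_in A B [set w; c] & boundary_in A (c |: B) [set w; t1; t2]],
      z \in c |: B
    & forall v, v \in A -> v \in G -> v \in [set w; t1; t2] \/ v = c].

Section FourCycle.

Variables (F G : {set V}) (w t1 t2 : V).
Hypotheses (FGready : ready F G) (wA : w \in A) (t1A : t1 \in A) (t2A : t2 \in A).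
Hypotheses (t12 : t1 != t2) (t1F : t1 \in F) (t2F : t2 \in F).
Hypotheses (wt1 : e w t1) (wt2 : e w t2).
Hypothesis Findep : forall u v, u \in A -> v \in A -> u \in F -> v \in F -> ~~ e u v.

Local Notation K := [set w; t1; t2].
Local Notation A' := (reach (A :\: K) G).
Local Notation FT := (nbrs [set t1; t2]).

Let w_t1 : w != t1. Proof. by apply/eqP => E; move: wt1; rewrite E e_irr. Qed.
Let w_t2 : w != t2. Proof. by apply/eqP => E; move: wt2; rewrite E e_irr. Qed.

Let sA' : A' \subset A :\: K. Proof. exact: reach_sub. Qed.

Let A'A v : v \in A' -> v \in A. Proof. by move/(subsetP sA')/setDP=> []. Qed.

Let A'K v : v \in A' -> v \notin K. Proof. by move/(subsetP sA')/setDP=> []. Qed.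

Let K_in v : (v \in K) = [|| v == w, v == t1 | v == t2].
Proof. by rewrite !inE orbA. Qed.

Let clA' u v : u \in A' -> v \in A -> e u v -> v \in A' \/ v \in K.
Proof.
move=> uA' vA euv; case: (boolP (v \in K)) => vK; [by right|left].
by apply: (reach_closed uA' _ euv); rewrite inE vK.
Qed.

Let meetA' Z z0 : Z \subset A' -> z0 \in Z -> boundary_in A' Z set0 ->
  exists2 g, g \in Z & g \in G.
Proof.
move=> sZ z0Z /bd0P bdZ; apply: (reach_meet e_sym sZ z0Z) => u v uZ vA euv.
by apply: (bdZ u) => //; apply: (reach_closed _ vA euv); apply: (subsetP sZ).
Qed.

Let FT_in v : (v \in FT) = e v t1 || e v t2.
Proof.
apply/nbrsP/orP => [[t /set2P[->|->]]|[ev|ev]]; rewrite 1?e_sym; auto.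
  by exists t1; rewrite ?inE ?eqxx // e_sym.
by exists t2; rewrite ?inE ?eqxx ?orbT // e_sym.
Qed.

(** Pockets are the obstacles to [linked A' FT G], where w is deleted and t1, t2 are contracted. The
    third kind of obstacle is excluded by [meetA']. *)
Let pocket Z c := [&& Z \subset A', [disjoint Z & FT], boundary_in A' Z (oset c) &
  (c == None) || [disjoint Z & G]].

Let pocket_bd Z c : pocket Z c -> boundary_in A Z (w |: oset c).
Proof.
case/and4P=> sZ /disjP dT /bdP bdZ _; apply/bdP => u v uZ vA euv.
have [vA'|] := clA' (subsetP sZ u uZ) vA euv.
  have [vZ|vc] := bdZ u v uZ vA' euv; [by left|right].
  by rewrite in_setU1 vc orbT.
have := dT u uZ; rewrite FT_in negb_or => /andP[/negP u1 /negP u2].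
rewrite K_in => /or3P[] /eqP E; first by right; rewrite E setU11.
  by case: u1; rewrite -E.
by case: u2; rewrite -E.
Qed.

Let pocket_cut Z z0 c : pocket Z (Some c) -> z0 \in Z -> c \in A' :\: Z.
Proof.
case/and4P=> sZ _ bdZ /= dG z0Z; apply/negPn/negP => cZ.
have [g gZ gG] := meetA' sZ z0Z (bd_set1 bdZ cZ).
by have := disjP _ _ dG g gZ; rewrite gG.
Qed.

Let KA : K \subset A.
Proof. by apply/subsetP => v; rewrite K_in => /or3P[] /eqP->. Qed.

Let trail_Kw t : t \in [set t1; t2] -> trail [set t; w] F [set w] 2.
Proof.
move=> tT; have [tF wt] : t \in F /\ e w t by case/set2P: tT => ->.
exists t, [:: w]; split=> //=; last by rewrite tF set11.
- by rewrite e_sym wt.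
- by rewrite inE andbT; apply/eqP => E; move: wt; rewrite E e_irr.
- by move=> v; rewrite !inE.
Qed.

(** A pocket without z supplies all the lengths by itself: its paths start at x directly or through
    t1 and w, and a fixed path from c to y completes them. *)
Let spread_clean_pocket Z z0 c : pocket Z c -> z0 \in Z -> z \notin Z ->
  spread d (trail A F G).
Proof.
move=> pZ z0Z zZ; have bdZ := pocket_bd pZ.
have /and4P[sZ dT bdZ' Gc] := pZ.
have sZA : Z \subset A by apply: subset_trans sZ (subset_trans sA' (subsetDl _ _)).
have ZK v : v \in Z -> v \notin K by move/(subsetP sZ)/A'K.
have wZ : w \notin Z by apply/negP => /ZK; rewrite K_in eqxx.
have t1Z : t1 \notin Z by apply/negP => /ZK; rewrite K_in eqxx orbT.
have t2Z : t2 \notin Z by apply/negP => /ZK; rewrite K_in eqxx !orbT.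
have cardZ : #|Z| + 2 <= #|A|.
  have <- : #|Z :|: [set t1; t2]| = #|Z| + 2.
    rewrite cardsU cards2 t12 (_ : Z :&: _ = set0) ?cards0 ?subn0 //.
    apply/setP => v; rewrite !inE; apply/negP => /andP[vZ /orP[]/eqP E].
      by rewrite -E vZ in t1Z.
    by rewrite -E vZ in t2Z.
  apply: subset_leq_card; rewrite subUset sZA; apply/subsetP => v.
  by case/set2P=> ->.
(* m counts the vertices of a path from c to y outside Z; it is 0 when y itself is a root of the
   pocket. *)
have [m sfx] : exists m, forall (S H : {set V}) k, S \subset Z :|: K ->
    trail S H (onbr G c) k -> trail A H G (k + m).
  have sU (S : {set V}) : S \subset Z :|: K -> S \subset A.
    by move=> sS; apply: subset_trans sS _; rewrite subUset sZA.
  case: c pZ Gc bdZ' {bdZ} => [c|] pZ /= dG bdZ'; last first.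
    by exists 0 => S H k sS; rewrite addn0; apply: trailW; apply: sU.
  have /setDP[cA' cZ] := pocket_cut pZ z0Z.
  have [m tr] : exists m, trail (A' :\: Z) [set c] G m.
    apply: (@trail_exists _ _ _ _ _ c); rewrite ?set11 // ?in_setD ?cZ //.
    move=> W sW cW clW.
    have sZW : Z :|: W \subset A'.
      by rewrite subUset sZ; apply: subset_trans sW (subsetDl _ _).
    have cZW : c \in Z :|: W by rewrite in_setU cW orbT.
    have bdZW : boundary_in A' (Z :|: W) set0.
      apply/bd0P => u v /setUP[uZ|uW] vA' euv.
        by have [vZ|/set1P->//] := bdP _ _ _ _ bdZ' u v uZ vA' euv; rewrite in_setU vZ.
      rewrite in_setU; case: (boolP (v \in Z)) => //= vZ.
      by apply: (clW u) => //; rewrite in_setD vZ.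
    have [g] := meetA' sZW cZW bdZW.
    move=> /setUP[gZ|gW] gG; last by exists g.
    by have := disjP _ _ dG g gZ; rewrite gG.
  exists m => S H k sS trS.
  apply: (trail_catr e_sym (sU S sS) _ _ trS tr).
    exact: subset_trans (subsetDl _ _) (subset_trans sA' (subsetDl _ _)).
  apply/disjP => v /(subsetP sS)/setUP[vZ|vK]; rewrite in_setD ?vZ //.
  by rewrite negb_and negbK; apply/orP; right; apply/negP => /A'K; rewrite vK.
have tr2 k : trail Z (nbr w) (onbr G c) k -> trail A F G (k + m + 2).
  move=> tr; rewrite [_ + 2]addnC addnA.
  apply: (sfx ([set t1; w] :|: Z)).
    rewrite subUset subsetUl andbT; apply/subsetP => v /set2P[]->;
    by rewrite in_setU K_in eqxx ?orbT.
  apply: (@trail_cat _ _ [set t1; w] Z _ _ _ w 2 k); rewrite ?subsetUl ?subsetUr //.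
    by apply/disjP => v /set2P[]->.
  by apply: trail_Kw; rewrite !inE eqxx.
have [] := @pocket_trichotomy F G Z z0 w c FGready sZA cardZ z0Z wZ zZ bdZ.
- by case: c Gc {pZ bdZ bdZ' sfx tr2}.
- apply: (@spread_shift d m) => k; apply: sfx.
  by rewrite subUset sub1set in_setU K_in eqxx orbT subsetUl.
- by apply: (@spread_shift d (m + 2)) => k /tr2; rewrite addnA.
(* Here d = 3, and the trails through q begin with q or with t1, w, q. *)
case=> q [EZ d3 qF ewq qc].
exists (1 + m); left => -[_|[_|i]]; last by move: d3; clear; lia.
  by rewrite addn0; apply: (sfx Z); rewrite ?subsetUl // EZ; apply: (@trail1 _ _ _ _ _ q); rewrite ?set11.
apply: (tr2 1).
by rewrite EZ; apply: (@trail1 _ _ _ _ _ q); rewrite ?set11 // inE.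
Qed.

(** B contains z and is the whole component of y, and w is its only boundary vertex. The rest of A
    is then a pocket attached at w and free of z; a fixed path from x to w through B precedes its
    paths. *)
Let spread_blind_pocket B z0 : pocket B None -> z0 \in B -> z \in B -> A' \subset B ->
  spread d (trail A F G).
Proof.
move=> pB z0B zB sA'B; have bdB := pocket_bd pB; rewrite setU0 in bdB.
have [lk degA] := FGready.
have /and4P[sB _ _ _] := pB.
have sBA : B \subset A by apply: subset_trans sB (subset_trans sA' (subsetDl _ _)).
have BK v : v \in B -> v \notin K by move/(subsetP sB)/A'K.
have wB : w \notin B by apply/negP => /BK; rewrite K_in eqxx.
have t1B : t1 \notin B by apply/negP => /BK; rewrite K_in eqxx orbT.
have t2B : t2 \notin B by apply/negP => /BK; rewrite K_in eqxx !orbT.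
pose O := A :\: (w |: B).
have sO : O \subset A by apply: subsetDl.
have wO : w \notin O by rewrite in_setD setU11.
have t1O : t1 \in O by rewrite in_setD t1A in_setU1 negb_or t1B eq_sym w_t1.
have t2O : t2 \in O by rewrite in_setD t2A in_setU1 negb_or t2B eq_sym w_t2.
have zO : z \notin O by rewrite in_setD in_setU1 zB orbT.
have bdO : boundary_in A O (w |: oset None).
  apply/bdP => u v; rewrite in_setD in_setU1 negb_or => /andP[/andP[uw uB] uA] vA euv.
  rewrite in_setU1 in_set0 orbF; case: (eqVneq v w) => [->|vw]; [by right|left].
  rewrite in_setD vA in_setU1 negb_or vw /= andbT; apply/negP => vB.
  have [|uB'|/set1P uw'] := bdP _ _ _ _ bdB v u vB uA; first by rewrite e_sym.
    by rewrite uB' in uB.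
  by rewrite uw' eqxx in uw.
have cardO : #|O| + 2 <= #|A|.
  rewrite (cardsD1 w A) wA (cardsD1 z0 (A :\ w)).
  have -> : z0 \in A :\ w.
    by rewrite in_setD1 (subsetP sBA) // andbT; apply: contraNneq wB => <-.
  suff : #|O| <= #|A :\ w :\ z0| by clear; lia.
  apply/subset_leq_card/subsetP => v.
  move=> /setDP[vA]; rewrite in_setU1 negb_or => /andP[vw vB].
  by rewrite !in_setD1 vw vA !andbT; apply: contraNneq vB => ->.
have [m tr] : exists m, trail B F (nbr w) m.
  have [H1 _ _] := lk B z0 sBA z0B; have [u uB uF] := H1 w bdB.
  apply: (@trail_exists _ _ _ _ _ u) => // W sW uW clW.
  case: (boolP [disjoint W & nbr w]) => [/disjP dw|/meetP//].
  have [_ _ H3] := lk W u (subset_trans sW sBA) uW.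
  have EW : W = A.
    apply: H3; apply/bd0P => a b aW bA eab.
    have [bB|/set1P bw] := bdP _ _ _ _ bdB a b (subsetP sW a aW) bA eab.
      exact: clW eab.
    by have := dw a aW; rewrite inE e_sym -bw eab.
  by case/negP: wB; apply: (subsetP sW); rewrite EW.
have [] := @pocket_trichotomy F G O t1 w None FGready sO cardO t1O wO zO bdO => //=.
- apply: (@spread_shift d 0) => k; rewrite addn0; apply: trailW.
  by rewrite subUset sub1set wA.
- apply: (@spread_shift d (m + 1)) => k trk; rewrite addnC.
  apply: (@trail_cat _ _ (w |: B) O _ _ _ w) trk; rewrite ?subUset ?sub1set ?wA //.
    by apply/disjP => v vB; rewrite in_setD vB.
  apply: (@trail_catr _ _ e_sym B [set w] _ _ _ w) tr _.
  - exact: subsetUr.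
  - exact: subsetUl.
  - by apply/disjP => v vB; rewrite in_set1; apply: contraNneq wB => <-.
  - by apply: (@trail1 _ _ _ _ _ w); apply: set11.
case=> q [EO _ _ _ _]; case/eqP: t12.
by rewrite EO in t1O t2O; rewrite (set1P t1O) (set1P t2O).
Qed.

(** All pockets may be supposed to contain z. A largest one, B, is removed with the 4-cycle. The
    remainder is linked, as an obstacle would yield a larger pocket, and c, the attachment of B,
    replaces z as the exceptional vertex. *)
Lemma spread_core :
  [\/ spread d (trail A F G), forall v, v \in A -> v \in G -> v \in K
    | exists B c, dead_end F G w t1 t2 B c].
Proof.
have [lk degA] := FGready.
case: (boolP [exists Z, [exists c, [&& pocket Z c, Z != set0 & z \notin Z]]]).
  case/existsP=> Z /existsP[c /and3P[pZ /set0Pn[z0 z0Z] zZ]].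
  by constructor 1; apply: spread_clean_pocket pZ z0Z zZ.
move=> clean; have zin Z c z0 : pocket Z c -> z0 \in Z -> z \in Z.
  move=> pZ z0Z; apply: contraNT clean => zZ; apply/existsP; exists Z.
  by apply/existsP; exists c; rewrite pZ zZ andbT; apply/set0Pn; exists z0.
have p0 : [exists c, pocket set0 c].
  apply/existsP; exists None; rewrite /pocket sub0set /= !andbT.
  apply/andP; split; first by apply/disjP => u; rewrite inE.
  by apply/bdP => u v; rewrite inE.
case: (@arg_maxnP _ set0 (fun Z => [exists c, pocket Z c]) (fun Z => #|Z|) p0) => B pB' maxB.
have {}maxB Z c : pocket Z c -> #|Z| <= #|B|.
  by move=> pZ; apply: maxB; apply/existsP; exists c.
(* An empty B gets the label [None], so that z stays the exceptional vertex. *)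
have [c pB cB] : exists2 c, pocket B c & (c -> exists b, b \in B).
  case: (set_0Vmem B) => [B0|[b bB]]; last first.
    by have /existsP[c pc] := pB'; exists c => // _; exists b.
  exists None => //; move: p0 => /existsP[c]; rewrite B0 /pocket => /and4P[-> -> _ _].
  by rewrite andbT; apply/bdP => u v; rewrite inE.
have {pB'}/and4P[sB dB bdB GB] := pB.
pose A3 := A' :\: B; pose exc := if c is Some c0 then c0 else z.
have sA3 : A3 \subset A' by apply: subsetDl.
have sc : oset c \subset [set exc] by rewrite /exc; case: (c) => //=; apply: sub0set.
have zA3 : forall v, v \in A3 -> v != exc -> v != z.
  move=> v /setDP[vA' vB]; rewrite /exc; move: pB cB; case: (c) => // c1 p1 [//|b bB] _.
  by apply: contraNneq vB => ->; apply: zin p1 bB.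
have lk3 : linked A3 FT G.
  move=> Z1 z1 s1 z1Z.
  (* An obstacle in A3 that contains the attachment of B is enlarged by B; any other is an obstacle
     in A' as it stands. *)
  have ext (Q : {set V}) : boundary_in A3 Z1 Q ->
      exists Z2, [/\ Z1 \subset Z2, Z2 \subset Z1 :|: B, boundary_in A' Z2 Q &
        Z2 = Z1 \/ [/\ B \subset Z2 & [disjoint B & G]]].
    move=> /bdP bd1.
    case: (boolP (if c is Some c0 then c0 \in Z1 else false)) => cZ1.
      exists (Z1 :|: B); rewrite subsetUl subxx subsetUr; split=> //; last first.
        by right; split=> //; move: GB cZ1; case: (c).
      apply/bdP => u v /setUP[u1|uB] vA' euv; rewrite in_setU.
        case: (boolP (v \in B)) => vB; first by left; rewrite orbT.
        have vA3 : v \in A3 by rewrite in_setD vB.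
        by have [->|] := bd1 u v u1 vA3 euv; [left|right].
      have [->|] := bdP _ _ _ _ bdB u v uB vA' euv; first by left; rewrite orbT.
      by move: cZ1; case: (c) => [c1|] /= cZ1; rewrite ?in_set0 // => /set1P->; left; rewrite cZ1.
    exists Z1; rewrite subxx subsetUl; split=> //; last by left.
    apply/bdP => u v u1 vA' euv; have /setDP[uA' uB] := subsetP s1 u u1.
    case: (boolP (v \in B)) => vB; last by apply: bd1 euv; rewrite // in_setD vB.
    have evu : e v u by rewrite e_sym.
    have [uB'|] := bdP _ _ _ _ bdB v u vB uA' evu; first by rewrite uB' in uB.
    move: cZ1; case: (c) => [c1|] /= cZ1; rewrite ?in_set0 // => /set1P E.
    by rewrite -E u1 in cZ1.
  have s1A' : Z1 \subset A' by apply: subset_trans s1 sA3.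
  have ext_dis (Z2 : {set V}) : Z1 \subset Z2 -> Z2 \subset Z1 :|: B ->
      (Z2 = Z1 \/ [/\ B \subset Z2 & [disjoint B & G]]) ->
      [disjoint Z1 & G] -> [disjoint Z2 & G].
    move=> _ /subsetP s2 [->//|[_ /disjP dBG]] /disjP dG; apply/disjP => u /s2/setUP[].
      exact: dG.
    exact: dBG.
  have no_pocket (Z2 : {set V}) c2 : Z1 \subset Z2 -> Z2 \subset Z1 :|: B ->
      (Z2 = Z1 \/ [/\ B \subset Z2 & [disjoint B & G]]) ->
      [disjoint Z1 & FT] -> boundary_in A' Z2 (oset c2) -> (c2 == None) || [disjoint Z2 & G] -> False.
    move=> s12 s21 H2 /disjP dT bd2 G2.
    have p2 : pocket Z2 c2.
      rewrite /pocket bd2 G2 !andbT; apply/andP; split.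
        by apply: subset_trans s21 _; rewrite subUset s1A'.
      apply/disjP => u /(subsetP s21)/setUP[/dT//|]; exact: (disjP _ _ dB).
    have z12 := subsetP s12 z1 z1Z; have z2 := zin _ _ _ p2 z12.
    have /setDP[_ z1B] := subsetP s1 z1 z1Z.
    case: H2 => [E2|[sB2 _]].
      rewrite E2 in z2; have /setDP[_ zB] := subsetP s1 z z2.
      case: (set_0Vmem B) => [B0|[b /(zin _ _ _ pB)]]; last by rewrite (negbTE zB).
      have := maxB _ _ p2; rewrite B0 cards0 leqn0 cards_eq0 => /eqP E0.
      by rewrite E0 inE in z12.
    have := maxB _ _ p2; rewrite leqNgt => /negP[]; apply: proper_card.
    by apply/properP; split=> //; exists z1.
  split.
  - move=> q dT dG; apply/negP => /ext[Z2 [s12 s21 bd2 H2]].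
    apply: (no_pocket Z2 (Some q)) => //=; exact: ext_dis dG.
  - move=> dT; apply/negP => /ext[Z2 [s12 s21 bd2 H2]].
    exact: (no_pocket Z2 None).
  move=> dG; apply/negP => /ext[Z2 [s12 s21 bd2 H2]].
  have [|g g2 gG] := meetA' _ (subsetP s12 z1 z1Z) bd2.
    by apply: subset_trans s21 _; rewrite subUset s1A'.
  by have := disjP _ _ (ext_dis Z2 s12 s21 H2 dG) g g2; rewrite gG.
case: (boolP [exists v in A3, v != exc]) => [/exists_inP ex3|/exists_inPn none].
  constructor 1; apply: (@spread_two d (trail A3 FT G)) => //; last first.
    apply: (@IH A3 FT G exc) => //.
      rewrite -ltnS; apply: leq_trans An; apply: proper_card; apply/properP; split.
        by apply: subset_trans sA3 (subset_trans sA' (subsetDl _ _)).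
      exists w => //; apply/negP => /(subsetP sA3)/A'K.
      by rewrite K_in eqxx.
    move=> v v3 vexc; have vz := zA3 v v3 vexc.
    have /setDP[vA' vB] := subsetP (subxx _) v v3; have vA := A'A vA'.
    have cards : #|A :&: nbr v| <= #|A3 :&: nbr v| + (e v w + (e v t1 + e v t2)).
      apply: (@leq_trans (#|A3 :&: nbr v| + #|K :&: nbr v|)).
        apply: card_nbr_le => u uA evu.
        have [uA'|] := clA' vA' uA evu; last by right.
        left; rewrite in_setD uA' andbT; apply: contra vexc => uB.
        have [|vB'|] := bdP _ _ _ _ bdB u v uB vA'; first by rewrite e_sym.
          by rewrite vB' in vB.
        by move=> /(subsetP sc); rewrite inE.
      rewrite leq_add2l -!(card_nbr1 e v) !setIUl.
      rewrite -setUA; apply: leq_trans (leq_card_setU _ _) _; rewrite leq_add2l.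
      exact: leq_card_setU.
    have deg_v := degA v vA vz.
    (* A vertex outside F loses up to three edges, but regains the new root if it is adjacent to t1
       or t2. A vertex of F is adjacent to neither, as F is independent, and loses only x and
       perhaps w. *)
    have loss : (v \in F) + (e v w + (e v t1 + e v t2)) <= 2 + (v \in FT).
      rewrite FT_in; case: (boolP (v \in F)) => vF; last first.
        by case: (e v w); case: (e v t1); case: (e v t2).
      rewrite (negbTE (Findep vA t1A vF t1F)) (negbTE (Findep vA t2A vF t2F)).
      by case: (e v w).
    by move: deg_v cards loss; rewrite /deg; clear; lia.
  (* The contracted pair is left at t, which is reached from x directly or by t', w, t. *)
  move=> k /trail_from_nbrs[t tT tr].
  have sA3A : A3 \subset A by apply: subset_trans sA3 (subset_trans sA' (subsetDl _ _)).
  have A3K : [disjoint K & A3].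
    by apply/disjP => v; apply: contraL => /(subsetP sA3)/A'K.
  have tK : t \in K by rewrite K_in; case/set2P: tT => ->; rewrite eqxx !orbT.
  have tF : t \in F by case/set2P: tT => ->.
  have tw : e w t by case/set2P: tT => ->.
  have [t' t'T t't] : exists2 t', t' \in [set t1; t2] & t' != t.
    case/set2P: tT => ->; first by exists t2; rewrite ?set22 // eq_sym.
    by exists t1; rewrite ?set21.
  split.
    apply: (@trail_cat _ _ K A3 _ _ _ t 1) tr => //.
    by apply: (@trail1 _ _ _ _ _ t); rewrite ?set11.
  apply: (@trail_cat _ _ K A3 _ _ _ t 3) tr => //.
  apply: (@trail_cat _ _ [set t'; w] [set t] _ _ _ w 2 1).
  - apply/subsetP => v /set2P[]->; rewrite K_in ?eqxx //.
    by case/set2P: t'T => ->; rewrite eqxx !orbT.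
  - by rewrite sub1set.
  - apply/disjP => v /set2P[]->; rewrite in_set1 //.
    by apply/eqP => E; move: tw; rewrite E e_irr.
  - exact: trail_Kw.
  by apply: (@trail1 _ _ _ _ _ t); rewrite ?set11 ?inE.
have A3exc v : v \in A3 -> v = exc by move/none/negPn/eqP.
(* If A3 is empty, either A' is empty and G stays within K, or B is all of A'. If A3 consists of
   [exc], there is a dead end. *)
case: (set_0Vmem A3) => [A30|[c0 c0A3]].
  have sA'B : A' \subset B.
    apply/subsetP => v vA'; apply/negPn/negP => vB.
    have : v \in A3 by rewrite in_setD vB.
    by rewrite A30 in_set0.
  case: (set_0Vmem B) => [B0|[b bB]].
    constructor 2 => v vA vG; apply/negPn/negP => vK.
    have /(subsetP sA'B) : v \in A' by apply: reach_base; rewrite // in_setD vK.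
    by rewrite B0 inE.
  constructor 1; apply: (@spread_blind_pocket B b) => //; last exact: zin pB bB.
  have := pB; case: (c) => // c1 p1; have /setDP[c1A' /negP[]] := pocket_cut p1 bB.
  exact: (subsetP sA'B).
have Ec0 := A3exc c0 c0A3; constructor 3; exists B, c0.
have /setDP[c0A' c0B] : c0 \in A' :\: B by [].
have EA' v : v \in A' -> v \in c0 |: B.
  move=> vA'; rewrite in_setU1; case: (boolP (v \in B)) => vB; first by rewrite orbT.
  by rewrite (A3exc v) ?Ec0 ?eqxx // in_setD vB.
have zcB : z \in c0 |: B.
  rewrite in_setU1 Ec0 /exc; case Ec: c => [c1|]; last by rewrite eqxx.
  by have [|b bB] := cB; rewrite ?Ec // (zin _ _ _ pB bB) orbT.
have dBG : [disjoint B & G].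
  have := GB; case Ec: c => [c1|] //= _.
  apply/disjP => b /(zin _ _ _ pB) zB; case/negP: c0B.
  by rewrite Ec0 /exc Ec.
have bdA'A' Q : boundary_in A' A' Q by apply/bdP => u v _ vA' _; left.
have sA'A' : A' \subset A' by [].
split.
- split; first exact: A'A.
  + have [g gA' gG] := meetA' sA'A' c0A' (bdA'A' set0).
    have /setU1P[<-//|gB] := EA' g gA'.
    by have := disjP _ _ dBG g gB; rewrite gG.
  + exact: A'K.
  rewrite -FT_in; apply/negPn/negP => c0T.
  have pA' : pocket A' None.
    rewrite /pocket sA'A' bdA'A' !andbT; apply/disjP => u /EA'/setU1P[->//|].
    exact: (disjP _ _ dB).
  have := maxB _ _ pA'; rewrite leqNgt => /negP[]; apply: proper_card.
  by apply/properP; split=> //; exists c0.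
- split=> //; last by apply: subset_trans sB (subset_trans sA' (subsetDl _ _)).
  by apply/disjP => b /(subsetP sB)/A'K.
- split.
    apply: bd_sub (pocket_bd pB); rewrite subUset sub1set set21 /=.
    by apply: subset_trans sc _; rewrite sub1set -Ec0 set22.
  apply/bdP => u v uc vA euv.
  have uA' : u \in A' by case/setU1P: uc => [->//|]; apply: (subsetP sB).
  by have [/EA'|] := clA' uA' vA euv; [left|right].
- exact: zcB.
move=> v vA vG; case: (boolP (v \in K)) => vK; [by left|right].
have /EA'/setU1P[//|vB] : v \in A' by apply: reach_base; rewrite // in_setD vK.
by have := disjP _ _ dBG v vB; rewrite vG.
Qed.

End FourCycle.
End Core.

(** * The induction *)

Section Assembly.

Variables (V : finType) (e : rel V).
Hypotheses (e_sym : symmetric e) (e_irr : irreflexive e).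

Implicit Types (A B F G Z T Q : {set V}) (u v w q z t : V).

Local Notation nbr := (nbr e).
Local Notation nbrs := (nbrs e).
Local Notation trail := (trail e).
Local Notation boundary_in := (boundary_in e).
Local Notation deg := (deg e).
Local Notation linked := (linked e).
Local Notation linked3 := (linked3 e).
Local Notation reach := (reach e).
Local Notation clique := (clique e).

Section Step.

Variables (n : nat) (A : {set V}) (z : V) (d : nat).
Hypotheses (IH : solvable_upto e n) (d_gt2 : 2 < d) (An : #|A| <= n.+1).

Local Notation ready := (ready e A z d).

(** * Roots on four-cycles *)

Definition indep F : Prop :=
  forall u v, u \in A -> v \in A -> u \in F -> v \in F -> ~~ e u v.

(** The vertices other than u form a set with no boundary vertex but u, so [linked3] makes it meet
    F. *)
Lemma ready_two F G u v : ready F G -> v \in A -> v != u ->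
  exists g, [/\ g \in A, g \in F & g != u].
Proof.
move=> [lk _] vA vu.
have vAu : v \in A :\ u by rewrite in_setD1 vu.
have [H _ _] := lk _ v (subsetDl A [set u]) vAu.
have [|g /setD1P[gu gA] gF] := H u; last by exists g.
apply/bd1P => a b _ bA _; case: (eqVneq b u) => bu; [by right|left].
by rewrite in_setD1 bu.
Qed.

(** A dead end yields a 4-cycle at y, namely y, w, t1, c if w is in G, or y, c, w, t2; failing both,
    N(y) = {c, t2} is contracted at no cost. A second dead end, seen from y, would have a pocket
    sharing z with B. The intersection of the pockets has no boundary vertex but w and avoids G,
    against [linked3]. *)
Lemma spread_dead_end F G w t1 t2 B c : ready F G -> indep F -> indep G ->
  w \in A -> t1 \in A -> t2 \in A -> t1 != t2 -> t1 \in F -> t2 \in F ->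
  e w t1 -> e w t2 -> dead_end e A z F G w t1 t2 B c -> e c t1 ->
  spread d (trail A F G).
Proof.
move=> rd iF iG wA t1A t2A t12 t1F t2F wt1 wt2.
case=> -[cA cG cK _] [cB dBG dBK sBA] [bdB bdcB] zcB GK ct1.
have [lk _] := rd.
have /and3P[cw_ ct1_ ct2_] : [&& c != w, c != t1 & c != t2].
  by move: cK; rewrite !inE !negb_or -andbA.
have BK v : v \in B -> [&& v != w, v != t1 & v != t2].
  by move=> /(disjP _ _ dBK); rewrite !inE !negb_or -andbA.
have t1G : t1 \notin G by apply/negP => t1G; have := iG c t1 cA t1A cG t1G; rewrite ct1.
have zt v : v \in [set t1; t2] -> z != v.
  move=> vT; apply: contraTneq zcB => ->; rewrite in_setU1 negb_or.
  case/set2P: vT => ->; first by rewrite eq_sym ct1_; apply/negP => /BK; rewrite eqxx !andbF.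
  by rewrite eq_sym ct2_; apply/negP => /BK; rewrite eqxx !andbF.
have meetG Z z0 q : Z \subset B -> z0 \in Z -> boundary_in A Z [set q] -> False.
  move=> /subsetP sZ z0Z; have [_ H _] := lk Z z0 (subset_trans (introT subsetP sZ) sBA) z0Z.
  by move=> /H[u /sZ uB]; rewrite (negbTE (disjP _ _ dBG u uB)).
have [wG|wG] := boolP (w \in G).
  apply: spreadC => //.
  have iwt1 : e t1 w by rewrite e_sym.
  have it1c : e t1 c by rewrite e_sym.
  have wc : w != c by rewrite eq_sym.
  have t2K : t2 \notin [set t1; w; c].
    rewrite !inE !negb_or eq_sym t12 /= eq_sym [t2 == c]eq_sym ct2_ andbT.
    by apply/eqP => E; move: wt2; rewrite E e_irr.
  have [//|al|[B' [c' [_ [_ _ dB' _] [bdB' _] zB' FK]]]] :=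
    @spread_core _ _ e_sym e_irr n A z d IH d_gt2 An G F t1 w c (readyC rd) t1A wA cA
      wc wG cG iwt1 it1c iG.
    by have := al t2 t2A t2F; rewrite (negbTE t2K).
  exfalso; have [|Ec'] := FK t2 t2A t2F; first by rewrite (negbTE t2K).
  have {}zB' : z \in B'.
    by move: zB'; rewrite in_setU1 -Ec' (negbTE (zt t2 (set22 _ _))).
  have zB : z \in B.
    move: zcB; rewrite in_setU1 => /orP[/eqP Ez|//].
    by have := disjP _ _ dB' z zB'; rewrite Ez !inE eqxx orbT.
  apply: (meetG (B :&: B') z w (subsetIl _ _)); first by rewrite in_setI zB.
  apply/bd1P => u v /setIP[uB uB'] vA euv; left; rewrite in_setI.
  have [vB|vwc] := bdP _ _ _ _ bdB u v uB vA euv;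
    have [vB'|vtc] := bdP _ _ _ _ bdB' u v uB' vA euv; rewrite ?vB ?vB' //.
  - have := BK v vB; move: vtc; rewrite -Ec' => /set2P[]->; by rewrite eqxx ?andbF.
  - have := disjP _ _ dB' v vB'; case/set2P: vwc => ->; by rewrite !inE eqxx ?orbT.
  move: vtc t2K; rewrite -Ec' !inE => vtc; case/set2P: vwc vtc => -> /orP[] /eqP E.
  - by move: wt1; rewrite E e_irr.
  - by rewrite E eqxx orbT.
  - by move: ct1; rewrite E e_irr.
  by move: ct2_; rewrite E eqxx.
have [g [gA gG gc]] : exists g, [/\ g \in A, g \in G & g != c].
  by apply: ready_two (readyC rd) t1A _; rewrite eq_sym.
have Gct v : v \in A -> v \in G -> v \in [set c; t2].
  move=> vA vG; have [|->] := GK v vA vG; last by rewrite set21.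
  rewrite -setUA => /setU1P[Ev|/set2P[Ev|->]]; last by rewrite set22.
    by rewrite -Ev vG in wG.
  by rewrite -Ev vG in t1G.
have t2G : t2 \in G.
  by have /set2P[E|<-//] := Gct g gA gG; rewrite E eqxx in gc.
have nct2 : e c t2 = false by apply: negbTE; apply: iG.
have nt12 : e t1 t2 = false by apply: negbTE; apply: iF.
apply: spreadC => //.
have [/exists_inP[u uA /andP[uc ut2]]|no_u] := boolP [exists u in A, e u c && e u t2].
  have ecu : e c u by rewrite e_sym.
  (* The neighbours of c in A lie in B or on the 4-cycle, and no vertex of B is adjacent to t2. *)
  have Eu : u = w.
    have [/setU1P[Eu|uB]|] := bdP _ _ _ _ bdcB c u (setU11 _ _) uA ecu.
    - by move: uc; rewrite Eu e_irr.
    - have [/BK|/set2P[E|E]] := bdP _ _ _ _ bdB u t2 uB t2A ut2.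
      + by rewrite eqxx !andbF.
      + by move: wt2; rewrite -E e_irr.
      + by move: ct2_; rewrite -E eqxx.
    rewrite -setUA => /setU1P[//|/set2P[] E]; first by rewrite E nt12 in ut2.
    by rewrite E e_irr in ut2.
  rewrite {}Eu in uc ut2 ecu {uA}.
  have t1K : t1 \notin [set w; c; t2].
    rewrite !inE !negb_or t12 andbT [t1 == c]eq_sym ct1_ andbT.
    by apply/eqP => E; move: wt1; rewrite E e_irr.
  have [//|al|[B' [c' [_ [_ _ dB' _] [bdB' _] zB' FK]]]] :=
    @spread_core _ _ e_sym e_irr n A z d IH d_gt2 An G F w c t2 (readyC rd) wA cA t2A
      ct2_ cG t2G uc ut2 iG.
    by have := al t1 t1A t1F; rewrite (negbTE t1K).
  exfalso; have [|Ec'] := FK t1 t1A t1F; first by rewrite (negbTE t1K).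
  have {}zB' : z \in B'.
    by move: zB'; rewrite in_setU1 -Ec' (negbTE (zt t1 (set21 _ _))).
  have zB : z \in B.
    move: zcB; rewrite in_setU1 => /orP[/eqP Ez|//].
    by have := disjP _ _ dB' z zB'; rewrite Ez !inE eqxx orbT.
  apply: (meetG (B :&: B') z w (subsetIl _ _)); first by rewrite in_setI zB.
  apply/bd1P => a v /setIP[aB aB'] vA eav; rewrite in_setI.
  have [vB|] := bdP _ _ _ _ bdB a v aB vA eav;
    have [vB'|vtc] := bdP _ _ _ _ bdB' a v aB' vA eav; rewrite ?vB ?vB' //.
  - by left.
  - have := BK v vB; move: vtc; rewrite -Ec' => /set2P[]->; by rewrite eqxx ?andbF.
  - case/set2P=> Ev; first by right.
    by have := disjP _ _ dB' v vB'; rewrite Ev !inE eqxx ?orbT.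
  case/set2P=> Ev; first by right.
  move: vtc; rewrite -Ec' Ev => /set2P[E|E]; first by rewrite E eqxx in cw_.
  by rewrite E eqxx in ct1_.
have Gsub : [set c; t2] \subset G by apply/subsetP => v /set2P[]->.
have Asub : [set c; t2] \subset A by apply/subsetP => v /set2P[]->.
apply: (spread_star e_sym IH An (readyC rd) Asub Gsub (set21 _ _) Gct).
  move=> v a b vA /set2P[]-> /set2P[]-> // va vb; case/exists_inP: no_u; exists v => //.
    by rewrite va vb.
  by rewrite va vb.
exists t1; last by rewrite eq_sym zt ?set21.
by apply: reach_base; rewrite // in_setD t1A andbT !inE negb_or eq_sym ct1_.
Qed.

(** [spread_core], used from both roots, leaves the case N(x) = N(y) = {t1, t2}, where a component
    of the rest is entered from one of t1, t2 and left to the other. If only w = z remains, d = 3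
    and the trails are t1 and t1, w, t2. *)
Lemma spread_fourcycle F G w t1 t2 : ready F G -> indep F -> indep G ->
  w \in A -> t1 \in A -> t2 \in A -> t1 != t2 -> t1 \in F -> t2 \in F ->
  e w t1 -> e w t2 -> spread d (trail A F G).
Proof.
move=> rd iF iG wA t1A t2A t12 t1F t2F wt1 wt2.
have [//|al|[B [c H]]] :=
  @spread_core _ _ e_sym e_irr n A z d IH d_gt2 An F G w t1 t2 rd wA t1A t2A
    t12 t1F t2F wt1 wt2 iF; last first.
  have [[_ _ _ /orP[ct1|ct2]] _ _ _ _] := H.
    exact: spread_dead_end H ct1.
  have H' : dead_end e A z F G w t2 t1 B c.
    have E : [set w; t2; t1] = [set w; t1; t2] by rewrite setUAC.
    by case: H => -[H1 H2 H3 H4] H5 H6 H7 H8; split; rewrite ?E //; split=> //; rewrite orbC.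
  by apply: spread_dead_end H' ct2 => //; rewrite eq_sym.
have wt1_ : w != t1 by apply/eqP => E; move: wt1; rewrite E e_irr.
have wt2_ : w != t2 by apply/eqP => E; move: wt2; rewrite E e_irr.
have wG : w \notin G.
  apply/negP => wG; have [|g [gA gG gw]] := @ready_two G F w t1 (readyC rd) t1A.
    by rewrite eq_sym.
  have := iG w g wA gA wG gG; have := al g gA gG.
  rewrite -setUA => /setU1P[E|/set2P[]->]; rewrite ?wt1 ?wt2 //.
  by rewrite E eqxx in gw.
have wF : w \notin F by apply/negP => wF; have := iF w t1 wA t1A wF t1F; rewrite wt1.
have GT v : v \in A -> v \in G -> v \in [set t1; t2].
  move=> vA vG; have := al v vA vG; rewrite -setUA => /setU1P[E|//].
  by rewrite -E vG in wG.
have TG : [set t1; t2] \subset G.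
  have [|g [gA gG gt1]] := @ready_two G F t1 t2 (readyC rd) t2A; first by rewrite eq_sym.
  have [|h [hA hG ht2]] := @ready_two G F t2 t1 (readyC rd) t1A; first by [].
  apply/subsetP => v /set2P[]->.
    by have /set2P[<-//|E] := GT h hA hG; rewrite E eqxx in ht2.
  by have /set2P[E|<-//] := GT g gA gG; rewrite E eqxx in gt1.
have t1G := subsetP TG t1 (set21 _ _); have t2G := subsetP TG t2 (set22 _ _).
have [/(spreadC e_sym)//|al'|[B [c [[cA cF _ ct] _ _ _ _]]]] :=
  @spread_core _ _ e_sym e_irr n A z d IH d_gt2 An G F w t1 t2 (readyC rd) wA t1A t2A
    t12 t1G t2G wt1 wt2 iG; last first.
  by case/orP: ct => ct; [have := iF c t1 cA t1A cF t1F | have := iF c t2 cA t2A cF t2F];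
     rewrite ct.
have FT v : v \in A -> v \in F -> v \in [set t1; t2].
  move=> vA vF; have := al' v vA vF; rewrite -setUA => /setU1P[E|//].
  by rewrite -E vF in wF.
have TA : [set t1; t2] \subset A by apply/subsetP => v /set2P[]->.
have TF v : v \in [set t1; t2] -> v \in F by case/set2P=> ->.
have T2 : #|[set t1; t2]| = 2 by rewrite cards2 t12.
have [/exists_inP[v0 /setDP[v0A v0T] v0z]|/exists_inPn none] :=
  boolP [exists v in A :\: [set t1; t2], v != z].
  apply: (@spread_twin _ _ e_sym n A z d IH An F G [set t1; t2] v0 0) => //.
  - move=> v /(subsetP (reach_sub _ _ _))/setDP[vA vT].
    by split; apply/negP => ?; case/negP: vT; auto.
  - move=> v t vA tT; rewrite add0n.
    have := @twin_loss _ _ e_sym [set t1; t2] t v tT; rewrite T2 add0n.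
    exact.
  move=> t t' [|[|j]] // tT t'T tt' _; apply: (@trail1 _ _ _ _ _ t); rewrite ?set11 ?TF //.
  by rewrite in_setD1 tt'.
have Ez v : v \in A -> v \notin [set t1; t2] -> v = z.
  by move=> vA vT; apply/eqP; have := none v; rewrite in_setD vA vT negbK; apply.
have wz : w = z by apply: Ez; rewrite // !inE negb_or wt1_.
have t1z : t1 != z by rewrite -wz eq_sym.
have d3 : d <= 3.
  have [_ degA] := rd; apply: leq_trans (degA t1 t1A t1z) _.
  rewrite /deg t1F t1G; suff : #|A :&: nbr t1| <= 1 by clear; lia.
  rewrite -(cards1 w); apply/subset_leq_card/subsetP => v /setIP[vA].
  rewrite !inE => et1v; have [/set2P[] E|vT] := boolP (v \in [set t1; t2]).
  - by rewrite E e_irr in et1v.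
  - by have := iF t1 t2 t1A t2A t1F t2F; rewrite -E et1v.
  by rewrite (Ez v) // wz.
exists 1; left => -[_|[_|i]]; last by move: d3; clear; lia.
  by apply: (@trail1 _ _ _ _ _ t1).
apply: (@trail_cat _ _ [set t1; w] [set t2] A F G w 2 1).
- by rewrite subUset !sub1set t1A.
- by rewrite sub1set.
- by apply/disjP => v /set2P[]->; rewrite inE.
- exists t1, [:: w]; split=> //=; rewrite ?inE ?andbT ?t1F ?eqxx 1?e_sym //.
  + by rewrite eq_sym.
  + by move=> v; rewrite !inE.
by apply: (@trail1 _ _ _ _ _ t2); rewrite ?inE.
Qed.

(** * Roots in no triangle and no four-cycle *)

Definition sparse F : Prop := forall v t t',
  v \in A -> t \in A -> t' \in A -> t \in F -> t' \in F -> e v t -> e v t' -> t = t'.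

(** Contracting N(x) fails only if nothing but z is reached from y. A neighbour of y outside F is
    then z, with at most one neighbour in A by sparsity, and [linked3] would put it in F. *)
Lemma star_root F G : ready F G -> indep F -> sparse F ->
  (exists2 v, v \in A & v != z) ->
  spread d (trail A F G) \/ forall v, v \in A -> v \in G -> v \in F.
Proof.
move=> rd iF spF [v0 v0A v0z]; have [lk _] := rd.
have [H _ _] := lk A v0 (subxx _) v0A.
have [|t tA tF] := H v0; first by apply/bd1P => u v _ vA _; left.
have tT : t \in A :&: F by rewrite inE tA.
have [/exists_inP exA'|/exists_inPn none] := boolP [exists v in reach (A :\: (A :&: F)) G, v != z].
  left; apply: (spread_star e_sym IH An rd (subsetIl _ _) (subsetIr _ _) tT _ _ exA').
    by move=> v vA vF; rewrite inE vA.
  by move=> v a b vA /setIP[aA aF] /setIP[bA bF]; apply: spF.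
right=> v vA vG; apply/negPn/negP => vF.
have vr : v \in reach (A :\: (A :&: F)) G.
  by apply: reach_base; rewrite // !inE vA (negbTE vF).
have nb u : u \in A -> e v u -> u \in F.
  move=> uA evu; apply/negPn/negP => uF.
  have ur : u \in reach (A :\: (A :&: F)) G.
    by apply: (reach_closed vr _ evu); rewrite !inE uA (negbTE uF).
  have Ev := negPn (none v vr); have Eu := negPn (none u ur).
  by move: evu; rewrite (eqP Ev) (eqP Eu) e_irr.
have [H1 _ _] := lk [set v] v (introT subsetP (fun u uv => etrans (congr1 _ (set1P uv)) vA)) (set11 v).
have [a bda] : exists a, boundary_in A [set v] [set a].
  have [/exists_inP[a aA eva]|/exists_inPn no] := boolP [exists a in A, e v a].
    exists a; apply/bd1P => u b /set1P-> bA evb; right.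
    by apply: (spF v) => //; apply: nb.
  by exists v; apply/bd1P => u b /set1P-> bA evb; have := no b bA; rewrite evb.
by have [u /set1P->] := H1 a bda; rewrite (negbTE vF).
Qed.

(** If both contractions fail, N(x) = N(y), and [spread_twin] uses a component of the rest. If only
    z can lie outside, its degree makes a common neighbour t adjacent to z; t is the only neighbour
    of z in A, against [linked3]. *)
Lemma spread_stars F G : ready F G -> indep F -> indep G -> sparse F -> sparse G ->
  (exists2 v, v \in A & v != z) -> spread d (trail A F G).
Proof.
move=> rd iF iG spF spG exA; have [lk degA] := rd.
have [//|GF] := star_root rd iF spF exA.
have [/(spreadC e_sym)//|FG] := star_root (readyC rd) iG spG exA.
pose T := A :&: F.
have TG : T \subset G by apply/subsetP => v /setIP[vA vF]; apply: FG.
have [/exists_inP[v0 /setDP[v0A v0T] v0z]|/exists_inPn none] := boolP [exists v in A :\: T, v != z].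
  apply: (@spread_twin _ _ e_sym n A z d IH An F G T v0 0 rd (subsetIl _ _) TG v0A v0T v0z).
  - move=> v /(subsetP (reach_sub _ _ _))/setDP[vA]; rewrite in_setI vA /= => vF.
    by split=> //; apply: contra vF => vG; apply: GF.
  - move=> v t vA tT; rewrite add0n.
    have le1 : #|T :&: nbr v| <= 1.
      apply/card_le1P => a; rewrite !inE => /andP[/andP[aA aF] eva] b.
      rewrite !inE; apply/idP/eqP => [/andP[/andP[bA bF] evb]|->].
        exact: (spF v).
      by rewrite aA aF eva.
    have [E|[a]] := set_0Vmem (T :&: nbr v); first by rewrite E cards0.
    case/setIP=> aT av; have eva : e v a by move: av; rewrite inE.
    apply: leq_trans le1 _.
    have [Ea|at_] := eqVneq a t; first by rewrite -Ea eva.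
    suff -> : v \in nbrs (T :\ t) by rewrite addn1.
    by apply: (@in_nbrs _ _ _ a); rewrite ?in_setD1 ?at_ // e_sym.
  move=> t t' [|[|j]] // tT t'T tt' _; apply: (@trail1 _ _ _ _ _ t); rewrite ?set11 //.
    by rewrite in_setD1 tt'.
  by case/setIP: tT.
have Ez v : v \in A -> v \notin F -> v = z.
  by move=> vA vF; apply/eqP; have := none v; rewrite !inE vA andbT vF negbK; apply.
have [t tA tz] := exA.
have tF : t \in F by apply: contraNT tz => tF; apply/eqP; apply: Ez.
have tG := FG t tA tF.
have nt u : u \in A -> e t u -> u = z.
  move=> uA etu; apply: Ez => //; apply/negP => uF.
  by have := iF t u tA uA tF uF; rewrite etu.
have [E|[u]] := set_0Vmem (A :&: nbr t).
  by have := leq_trans d_gt2 (degA t tA tz); rewrite /deg E cards0 tF tG.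
case/setIP=> uA ut; have etu : e t u by move: ut; rewrite inE.
have Eu := nt u uA etu; rewrite {}Eu in uA etu.
have zF : z \notin F by apply/negP => zF; have := iF t z tA uA tF zF; rewrite etu.
have [|H _ _] := lk [set z] z _ (set11 z); first by rewrite sub1set.
have [|v /set1P->] := H t; last by rewrite (negbTE zF).
apply/bd1P => a b /set1P-> bA ezb; right; apply: (spF z) => //; last by rewrite e_sym.
apply/negPn/negP => bF; move: ezb; by rewrite (Ez b bA bF) e_irr.
Qed.

(** * Roots in triangles *)

Lemma max_clique F u v : u \in A -> v \in A -> u \in F -> v \in F -> e u v ->
  exists T, [/\ T \subset A, T \subset F, clique T, 1 < #|T|
    & forall w, w \in A -> w \in F -> (forall t, t \in T -> e w t) -> False].
Proof.
move=> uA vA uF vF euv.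
pose P (T : {set V}) := [&& T \subset A :&: F, 1 < #|T| &
  [forall a in T, forall b in T, (a != b) ==> e a b]].
have cliqueP T : reflect (clique T) [forall a in T, forall b in T, (a != b) ==> e a b].
  apply: (iffP forall_inP) => [H a b aT bT ab|H a aT].
    by have /forall_inP/(_ b bT)/implyP/(_ ab) := H a aT.
  by apply/forall_inP => b bT; apply/implyP; apply: H.
have uv : u != v by apply/eqP => E; move: euv; rewrite E e_irr.
have P0 : P [set u; v].
  apply/and3P; split; last 2 first.
  - by rewrite cards2 uv.
  - by apply/cliqueP => a b /set2P[]-> /set2P[]->; rewrite ?eqxx // e_sym.
  by apply/subsetP => w /set2P[]->; rewrite inE ?uA ?vA.
case: (@arg_maxnP _ [set u; v] P (fun T : {set V} => #|T|) P0) => T /and3P[sT T1 /cliqueP cl] maxT.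
have := sT; rewrite subsetI => /andP[sA sF]; exists T; split=> // w wA wF wT.
have wT' : w \notin T by apply/negP => /wT; rewrite e_irr.
suff /maxT : P (w |: T) by rewrite /= cardsU1 wT' add1n ltnn.
apply/and3P; split.
- by rewrite subUset sT andbT sub1set inE wA.
- by rewrite cardsU1 wT'; move: T1; clear; lia.
apply/cliqueP => a b /setU1P[->|aT] /setU1P[->|bT]; rewrite ?eqxx //.
- by move=> _; apply: wT.
- by move=> _; rewrite e_sym; apply: wT.
exact: cl.
Qed.

(** The contraction of T fails only if nothing but z is reached from y outside T. Neighbours of a
    reached z outside T would be reached too. *)
Lemma clique_root F G T : ready F G -> T \subset A -> T \subset F ->
  clique T -> 1 < #|T| ->
  (forall v, v \in A -> v \in F -> (forall t, t \in T -> e v t) -> False) ->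
  spread d (trail A F G) \/
  (forall v, v \in A -> v \in G -> v \in T \/ v = z) /\
  (z \in A -> z \in G -> z \notin T -> forall u, u \in A -> e z u -> u \in T).
Proof.
move=> rd sA sF cl T1 maxT.
have [/exists_inP exA'|/exists_inPn none] := boolP [exists v in reach (A :\: T) G, v != z].
  by left; apply: (spread_clique e_sym IH d_gt2 An rd sA sF cl T1 maxT exA').
right; split=> [v vA vG|zA zG zT u uA ezu].
  have [vT|vT] := boolP (v \in T); [by left|right].
  by apply/eqP/negPn/none/reach_base; rewrite // inE vT.
apply/negPn/negP => uT.
have zr : z \in reach (A :\: T) G by apply: reach_base; rewrite // inE zT.
have ur : u \in reach (A :\: T) G by apply: (reach_closed zr _ ezu); rewrite inE uT.
by move: ezu; rewrite (eqP (negPn (none u ur))) e_irr.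
Qed.

Lemma isolated_not_reached T v0 v : v0 != z ->
  (z \in A -> z \notin T -> forall u, u \in A -> e z u -> u \in T) ->
  v \in reach (A :\: T) [set v0] -> v != z.
Proof.
move=> v0z iso vr; apply: contraNneq v0z => Ev; rewrite {v}Ev in vr.
have /setDP[zA zT] := subsetP (reach_sub _ _ _) z vr.
have [|||g /set1P-> /set1P->//] := @reach_meet _ _ e_sym (A :\: T) [set v0] [set z] z.
- by rewrite sub1set.
- exact: set11.
by move=> a b /set1P-> /setDP[bA bT] /(iso zA zT b bA); rewrite (negbTE bT).
Qed.

(** A component outside T is entered from t and left to t'. The segment inside T minus t' has any
    number of vertices up to |T| - 1, which matches the loss |T| - 2. Without such a component, A is
    T with or without z, and the trails are explicit. *)
Lemma spread_two_cliques F G T : ready F G -> T \subset A -> T \subset F ->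
  T \subset G -> clique T -> 1 < #|T| ->
  (forall v, v \in A -> v \notin T -> v != z -> v \notin F /\ v \notin G) ->
  (z \in A -> z \notin T -> (z \in F) || (z \in G) ->
     forall u, u \in A -> e z u -> u \in T) ->
  spread d (trail A F G).
Proof.
move=> rd sA sF sG cl T1 out iso; have [lk degA] := rd.
have [/exists_inP[v0 /setDP[v0A v0T] v0z]|/exists_inPn none] := boolP [exists v in A :\: T, v != z].
  apply: (@spread_twin _ _ e_sym n A z d IH An F G T v0 (#|T| - 2) rd sA sG v0A v0T v0z).
  - move=> v vr; have /setDP[vA vT] := subsetP (reach_sub _ _ _) v vr.
    have [Ev|vz] := eqVneq v z; last exact: out.
    apply/andP; rewrite -negb_or; apply/negP => FGv.
    have /negP[] : v != z; last by rewrite Ev.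
    by apply: isolated_not_reached v0z _ vr => zA zT; apply: iso => //; rewrite -Ev.
  - by move=> v t vA tT; apply: twin_loss.
  move=> t t' j tT t'T tt' jT; apply: (clique_trail e_sym).
  - by move=> a b /setD1P[_ aT] /setD1P[_ bT]; apply: cl.
  - exact: subset_trans (subsetDl _ _) sF.
  - by rewrite in_setD1 tt'.
  by move: jT T1; rewrite (cardsD1 t' T) t'T; clear; lia.
have Ez v : v \in A -> v \notin T -> v = z.
  by move=> vA vT; apply/eqP; have := none v; rewrite inE vA andbT vT negbK; apply.
have [t tT tz] : exists2 t, t \in T & t != z.
  have [t /setD1P[tz tT]] : exists t, t \in T :\ z; last by exists t.
  by apply/set0Pn; rewrite -card_gt0; move: T1; rewrite (cardsD1 z); case: (z \in T); clear; lia.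
have trT k : 0 < k <= #|T| -> trail A F G k.
  move=> kT; apply: (@trail_sub _ _ T A F F [set t]) => //.
    by move=> v vT /set1P->; apply: (subsetP sG).
  exact: (clique_trail e_sym).
have degt := degA t (subsetP sA t tT) tz.
have cardT : #|T :&: nbr t| <= #|T|.-1.
  rewrite -ltnS (ltn_predK T1); apply: proper_card; apply/properP; split; first exact: subsetIl.
  by exists t; rewrite // in_setI inE e_irr andbF.
have [dT|] := leqP d #|T|.+1.
  by exists 1; right => i id_; apply: trT; move: dT id_ T1; clear; lia.
move=> dT; have [zA|zA] := boolP (z \in A :\: T); last first.
  suff : d <= #|T|.+1 by rewrite leqNgt dT.
  apply: leq_trans degt _; rewrite /deg (subsetP sF t tT) (subsetP sG t tT).
  suff : #|A :&: nbr t| <= #|T :&: nbr t| by move: cardT T1; clear; lia.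
  apply: card_nbr0_le => u uA _; apply/negPn/negP => uT.
  by move: zA; rewrite -(Ez u uA uT) inE uA uT.
have {zA} /setDP[zA zT] := zA.
have d2 : d <= #|T|.+2.
  apply: leq_trans degt _; rewrite /deg (subsetP sF t tT) (subsetP sG t tT).
  suff : #|A :&: nbr t| <= #|T :&: nbr t| + 1 by move: cardT T1; clear; lia.
  apply: leq_trans (card_nbr1_le (w := z) (B := T) _) _.
    move=> u uA _; have [uT|uT] := boolP (u \in T); [by left|right; exact: Ez].
  by rewrite leq_add2l leq_b1.
(* Now d = |T| + 2, which asks for one more trail, through z and all of T. *)
suff trz : trail A F G #|T|.+1.
  exists 1; right => i id_; have [iT|iT] := ltnP i #|T|; first by apply: trT; rewrite add1n.
  suff -> : 1 + i = #|T|.+1 by [].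
  by move: iT id_ d2; clear; lia.
have nbz u : u \in A -> e z u -> u \in T.
  by move=> uA ezu; apply/negPn/negP => uT; move: ezu; rewrite (Ez u uA uT) e_irr.
have [|H1 H2 H3] := lk [set z] z _ (set11 z); first by rewrite sub1set.
have [a aA eza] : exists2 a, a \in A & e z a.
  have [/exists_inP//|/exists_inPn no] := boolP [exists a in A, e z a].
  have : t \in [set z]; last by rewrite inE (negbTE tz).
  rewrite H3 ?(subsetP sA) //; apply/bd0P => u b /set1P-> bA ezb.
  by have := no b bA; rewrite ezb.
have aT := nbz a aA eza.
(* Given a second neighbour b of z, the trail ends with a, z, b. Otherwise {z} has the single
   boundary vertex a, so z is adjacent to x and the trail starts there. *)
have [/exists_inP[b bA /andP[ezb ba]]|/exists_inPn no] := boolP [exists b in A, e z b && (b != a)].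
  have bT := nbz b bA ezb; have za : e a z by rewrite e_sym.
  have tr1 : trail (T :\ b) F [set a] #|T|.-1.
    apply: (clique_trail e_sym); last by rewrite (cardsD1 b T) bT in T1 *; move: T1; clear; lia.
    - by move=> u v /setD1P[_ uT] /setD1P[_ vT]; apply: cl.
    - exact: subset_trans (subsetDl _ _) sF.
    by rewrite in_setD1 eq_sym ba.
  have tr2 : trail [set z; b] (nbr a) G 2.
    exists z, [:: b]; split=> //=; rewrite ?inE ?ezb ?andbT //.
    - by apply: contraNneq zT => ->.
    - by move=> v; rewrite !inE.
    by rewrite za (subsetP sG).
  rewrite (_ : #|T|.+1 = #|T|.-1 + 2); last by move: T1; clear; lia.
  apply: trail_cat tr1 tr2.
  - exact: subset_trans (subsetDl _ _) sA.
  - by rewrite subUset !sub1set zA.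
  apply/disjP => v /setD1P[vb vT]; rewrite !inE (negbTE vb) orbF.
  by apply: contraNneq zT => <-.
have bda : boundary_in A [set z] [set a].
  apply/bd1P => u b /set1P-> bA ezb; right; apply/eqP.
  by have := no b bA; rewrite ezb negbK.
have zF : z \in F by have [u /set1P->] := H1 a bda.
apply: (@trail_cat _ _ [set z] T A F G z 1 #|T|) => //.
- by rewrite sub1set.
- by apply/disjP => v /set1P->.
- by apply: (@trail1 _ _ _ _ _ z); rewrite ?set11.
apply: (trail_rev e_sym); apply: (@trail_sub _ _ T T G G [set a]) => //.
  by move=> v _ /set1P->; rewrite inE.
by apply: (clique_trail e_sym); rewrite // leqnn andbT ltnW.
Qed.

(** G meets the clique in one vertex t only, so z is in G as well, and a neighbour t' of z in T
    closes the 4-cycle y, z, t', t. As z is on this cycle, [spread_core] from y yields no dead end,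
    and N(x) lies within the cycle. *)
Lemma spread_clique_indep F G T : ready F G -> indep G ->
  T \subset A -> T \subset F -> clique T -> 1 < #|T| ->
  (forall v, v \in A -> v \in G -> v \in T \/ v = z) ->
  (z \in A -> z \in G -> z \notin T -> forall u, u \in A -> e z u -> u \in T) ->
  spread d (trail A F G).
Proof.
move=> rd iG sA sF cl T1 GT iso; have [lk degA] := rd.
have [u uT uz] : exists2 t, t \in T & t != z.
  have [t /setD1P[tz tT]] : exists t, t \in T :\ z; last by exists t.
  by apply/set0Pn; rewrite -card_gt0; move: T1; rewrite (cardsD1 z); case: (z \in T); clear; lia.
have uA := subsetP sA u uT.
have [t [tA tG tz]] := ready_two (readyC rd) uA uz.
have tT : t \in T by have [//|E] := GT t tA tG; rewrite E eqxx in tz.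
have [u' u'A u't] : exists2 u', u' \in A & u' != t.
  have [u' /setD1P[u't u'T]] : exists u', u' \in T :\ t; last by exists u' => //; apply: (subsetP sA).
  by apply/set0Pn; rewrite -card_gt0; move: T1; rewrite (cardsD1 t) tT; clear; lia.
have nTG v : v \in T -> v \in G -> v = t.
  move=> vT vG; apply/eqP/negPn/negP => vt.
  by have := iG v t (subsetP sA v vT) tA vG tG; rewrite cl.
have [zG zA] : z \in G /\ z \in A.
  have [g [gA gG gt]] := ready_two (readyC rd) u'A u't.
  by have [/nTG/(_ gG) E|<-//] := GT g gA gG; rewrite E eqxx in gt.
have zT : z \notin T by apply: contra tz => /nTG/(_ zG)->.
have nbz := iso zA zG zT.
have zt : e z t = false by apply: negbTE; apply: iG.
have [|H1 H2 H3] := lk [set z] z _ (set11 z); first by rewrite sub1set.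
have [t' t'A ezt'] : exists2 a, a \in A & e z a.
  have [/exists_inP//|/exists_inPn no] := boolP [exists a in A, e z a].
  have : t \in [set z]; last by rewrite inE (negbTE tz).
  rewrite H3 //; apply/bd0P => a b /set1P-> bA ezb.
  by have := no b bA; rewrite ezb.
have t'T := nbz t' t'A ezt'.
have t't : t' != t by apply/eqP => E; rewrite E zt in ezt'.
have et't := cl t' t t'T tT t't.
have et'z : e t' z by rewrite e_sym.
have zt_ : z != t by rewrite eq_sym.
apply: spreadC => //.
have [//|al|[B [c [[_ _ cK _] [_ _ dB _] _ zB _]]]] :=
  @spread_core _ _ e_sym e_irr n A z d IH d_gt2 An G F t' z t (readyC rd) t'A zA tA
    zt_ zG tG et'z et't iG; last first.
  have zK : z \in [set t'; z; t] by rewrite !inE eqxx orbT.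
  case/setU1P: zB => [Ez|zB]; first by rewrite -Ez zK in cK.
  by have := disjP _ _ dB z zB; rewrite zK.
apply: spreadC => //.
have t'F := subsetP sF t' t'T; have tF := subsetP sF t tT.
pose T2 := [set t'; t].
have sT2A : T2 \subset A by apply/subsetP => v /set2P[]->.
have inT2 v : v \in A -> v \in F \/ v \in G -> v != z -> v \in T2.
  move=> vA [vF|vG] vz.
    have := al v vA vF; rewrite !inE => /orP[/orP[->//|]|->]; last by rewrite orbT.
    by rewrite (negbTE vz).
  have [vT|E] := GT v vA vG; first by rewrite (nTG v vT vG) set22.
  by rewrite E eqxx in vz.
have nbz2 v : v \in A -> e z v -> v \in T2.
  move=> vA ezv; apply: inT2 => //; first by left; apply/(subsetP sF)/nbz.
  by apply: contraTneq ezv => ->; rewrite e_irr.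
have cT2 : #|T2| = 2 by rewrite cards2 t't.
have [/exists_inP[v0 /setDP[v0A v0T] v0z]|/exists_inPn none] := boolP [exists v in A :\: T2, v != z].
  have out v : v \in reach (A :\: T2) [set v0] -> v \notin F /\ v \notin G.
    move=> vr; have /setDP[vA vT] := subsetP (reach_sub _ _ _) v vr.
    have vz : v != z by apply: isolated_not_reached v0z _ vr.
    by split; apply: contra vT => ?; apply: inT2; auto.
  (* t' is not in G, so the component has to be entered from t' and left to t. *)
  apply: (@spread_twin_at _ _ e_sym n A z d IH An F G T2 t' v0 0 rd sT2A (set21 _ _)
    _ v0A v0T v0z out).
  - by apply/subsetP => v /setD1P[vt' /set2P[E|->//]]; rewrite E eqxx in vt'.
  - set D := reach _ _; apply/negPn/negP => t'D.
    have v0D : v0 \in D by apply: reach_base; rewrite ?in_set1 // in_setD v0T.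
    have sDA : D \subset A by apply: subset_trans (reach_sub _ _ _) (subsetDl _ _).
    have [_ H _] := lk D v0 sDA v0D.
    have [|v vD] := H t; last by have [_ /negbTE->] := out v vD.
    apply/bd1P => a b aD bA eab; have [bT|bT] := boolP (b \in T2); last first.
      by left; apply: reach_closed aD _ eab; rewrite in_setD bT.
    case/set2P: bT => Eb; last by right.
    by case/negP: t'D; apply: (in_nbrs aD); rewrite -Eb.
  - move=> v vA; have := @twin_loss _ _ e_sym T2 t' v (set21 _ _); rewrite cT2.
    exact.
  move=> t2 [|[|j]] // t2T t't2 _; apply: (@trail1 _ _ _ _ _ t'); rewrite ?set11 //.
  by rewrite in_setD1 t't2 set21.
have Ez v : v \in A -> v \notin T2 -> v = z.
  by move=> vA vT; apply/eqP; have := none v; rewrite in_setD vA vT negbK; apply.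
have d3 : d <= 3.
  apply: leq_trans (degA t tA tz) _.
  rewrite /deg tF tG; suff : #|A :&: nbr t| <= 1 by clear; lia.
  rewrite -(cards1 t'); apply/subset_leq_card/subsetP => v /setIP[vA].
  rewrite !inE => etv.
  have [/set2P[->//|E]|vT] := boolP (v \in T2); first by rewrite E e_irr in etv.
  by move: etv; rewrite (Ez v vA vT) e_sym zt.
exists 1; right => -[_|[_|i]]; last by move: d3; clear; lia.
  by apply: (@trail1 _ _ _ _ _ t).
exists t', [:: t]; split=> //=; rewrite ?inE ?et't ?andbT ?t'F //.
by move=> v; rewrite !inE => /orP[]/eqP->.
Qed.

(** If y lies in a triangle too, the maximum cliques T and T' of N(x) and N(y) differ at most in z,
    and their intersection is one of them. *)
Lemma spread_triangle F G u v : ready F G -> u \in A -> v \in A ->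
  u \in F -> v \in F -> e u v -> spread d (trail A F G).
Proof.
move=> rd uA vA uF vF euv.
have [T [sA sF cl T1 maxT]] := max_clique uA vA uF vF euv.
have [//|[GT isoG]] := clique_root rd sA sF cl T1 maxT.
have [/exists_inP[a aA /exists_inP[b bA /and3P[aG bG eab]]]|] :=
    boolP [exists a in A, exists b in A, [&& a \in G, b \in G & e a b]]; last first.
  move/exists_inPn => no; apply: (spread_clique_indep rd _ sA sF cl T1 GT isoG).
  move=> a b aA bA aG bG; have /exists_inPn/(_ b bA) := no a aA.
  by rewrite aG bG.
have [T' [sA' sG' cl' T1' maxT']] := max_clique aA bA aG bG eab.
have [/(spreadC e_sym)//|[FT' isoF]] := clique_root (readyC rd) sA' sG' cl' T1' maxT'.
have TT' t : t \in T -> t != z -> t \in T'.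
  move=> tT tz; have [//|E] := FT' t (subsetP sA t tT) (subsetP sF t tT).
  by rewrite E eqxx in tz.
have T'T t : t \in T' -> t != z -> t \in T.
  move=> tT tz; have [//|E] := GT t (subsetP sA' t tT) (subsetP sG' t tT).
  by rewrite E eqxx in tz.
have out w : w \in A -> w \notin T :&: T' -> w != z -> w \notin F /\ w \notin G.
  move=> wA wT wz; split; apply: contra wT => wFG; rewrite inE.
    by have [wT'|E] := FT' w wA wFG; [rewrite wT' T'T | rewrite E eqxx in wz].
  by have [wT|E] := GT w wA wFG; [rewrite wT TT' | rewrite E eqxx in wz].
apply: (@spread_two_cliques F G (T :&: T') rd).
- exact: subset_trans (subsetIl _ _) sA.
- exact: subset_trans (subsetIl _ _) sF.
- exact: subset_trans (subsetIr _ _) sG'.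
- by move=> p q /setIP[pT _] /setIP[qT _]; apply: cl.
- have [zT|zT] := boolP (z \in T); have [zT'|zT'] := boolP (z \in T').
  + rewrite (_ : T :&: T' = T) //; apply/setIidPl/subsetP => t tT.
    by have [->|tz] := eqVneq t z; [ | apply: TT'].
  + rewrite (_ : T :&: T' = T') //; apply/setIidPr/subsetP => t tT.
    by apply: T'T => //; apply: contraNneq zT' => <-.
  + rewrite (_ : T :&: T' = T) //; apply/setIidPl/subsetP => t tT.
    by apply: TT' => //; apply: contraNneq zT => <-.
  rewrite (_ : T :&: T' = T) //; apply/setIidPl/subsetP => t tT.
  by apply: TT' => //; apply: contraNneq zT => <-.
- exact: out.
move=> zA; rewrite in_setI negb_and => zTT' zFG w wA ezw.
have wz : w != z by apply: contraTneq ezw => ->; rewrite e_irr.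
suff : (w \in T) || (w \in T').
  by rewrite in_setI => /orP[wT|wT']; [rewrite wT TT' | rewrite wT' T'T].
case/orP: zTT' => zT.
  have [zG|zG] := boolP (z \in G); first by rewrite (isoG zA zG zT w).
  move: zFG; rewrite (negbTE zG) orbF => zF.
  have [zT'|zT'] := boolP (z \in T'); last by rewrite (isoF zA zF zT' w) ?orbT.
  by rewrite (subsetP sG' z zT') in zG.
have [zF|zF] := boolP (z \in F); first by rewrite (isoF zA zF zT w) ?orbT.
move: zFG; rewrite (negbTE zF) /= => zG.
have [zT'|zT'] := boolP (z \in T); last by rewrite (isoG zA zG zT' w).
by rewrite (subsetP sF z zT') in zF.
Qed.

Lemma spread_ready F G : ready F G -> (exists2 v, v \in A & v != z) ->
  spread d (trail A F G).
Proof.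
move=> rd exA.
have decide (H : {set V}) : (exists u v, [/\ u \in A, v \in A, u \in H, v \in H & e u v]) \/ indep H.
  have [/exists_inP[u uA /exists_inP[v vA /and3P[uH vH euv]]]|] :=
    boolP [exists u in A, exists v in A, [&& u \in H, v \in H & e u v]].
    by left; exists u, v.
  move/exists_inPn => no; right=> u v uA vA uH vH.
  by have /exists_inPn/(_ v vA) := no u uA; rewrite uH vH.
have [[u [v [uA vA uF vF euv]]]|iF] := decide F; first exact: spread_triangle euv.
have [[u [v [uA vA uG vG euv]]]|iG] := decide G.
  by apply: spreadC => //; apply: spread_triangle (readyC rd) uA vA uG vG euv.
have decide4 (H : {set V}) : (exists w t t', [/\ w \in A, t \in A /\ t' \in A, t != t',
    t \in H /\ t' \in H & e w t /\ e w t']) \/ sparse H.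
  have [/exists_inP[w wA /exists_inP[t tA /exists_inP[t' t'A]]]|] :=
    boolP [exists w in A, exists t in A, exists t' in A,
      [&& t != t', t \in H, t' \in H, e w t & e w t']].
    by case/and5P=> tt' tH t'H wt wt'; left; exists w, t, t'.
  move/exists_inPn => no; right=> w t t' wA tA t'A tH t'H wt wt'.
  have /exists_inPn/(_ t tA)/exists_inPn/(_ t' t'A) := no w wA.
  by rewrite tH t'H wt wt' !andbT negbK => /eqP.
have [[w [t [t' [wA [tA t'A] tt' [tF t'F] [wt wt']]]]]|sF] := decide4 F.
  exact: spread_fourcycle rd iF iG wA tA t'A tt' tF t'F wt wt'.
have [[w [t [t' [wA [tA t'A] tt' [tG t'G] [wt wt']]]]]|sG] := decide4 G.
  apply: spreadC => //.
  exact: spread_fourcycle (readyC rd) iG iF wA tA t'A tt' tG t'G wt wt'.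
exact: spread_stars.
Qed.

End Step.

Lemma solvable n : solvable_upto e n.
Proof.
elim: n => [|n IHn] A F G z d An lk degA exA.
  by case: exA => v; move: An; rewrite leqn0 cards_eq0 => /eqP->; rewrite inE.
have [d2|d3] := leqP d 2; last first.
  have [//|lk3] := spread_or_linked3 e_sym e_irr IHn d3 An lk degA exA.
  exact: (spread_ready IHn d3 An (conj lk3 degA) exA).
(* For d at most 2 a single path is enough. *)
have [v0 v0A _] := exA.
have [u uA uF] : exists2 u, u \in A & u \in F.
  have [_ H _] := lk A v0 (subxx _) v0A; apply/meetP/negP => /H/negP[].
  by apply/bd0P.
have [|m tr] := @trail_exists _ e A F G u uA uF.
  move=> Z sZ uZ clZ; have [_ _ H] := lk Z u sZ uZ.
  by apply/meetP/negP => /H/negP[]; apply/bd0P.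
by exists m; left => -[|i]; rewrite ?addn0 //; move: d2; clear; lia.
Qed.

End Assembly.

(** * Blocks *)

Section Blocks.

Variables (T : finType) (e : rel T).
Hypotheses (e_sym : symmetric e) (e_irr : irreflexive e).

Lemma closed_full (W : {set T}) u : connected_in e [set: T] -> u \in W ->
  closed_in e [set: T] W -> W = [set: T].
Proof.
case/andP=> _ /forall_inP conn uW clW; apply/eqP; rewrite -subTset; apply/subsetP => v _.
have /forall_inP/(_ v (in_setT v)) := conn u (in_setT u).
exact: closed_in_connect clW uW.
Qed.

(** A minimal separated Z forms an end block with its attachment q. No proper part of Z has a single
    attachment, so [q |: Z] has no cut vertex of its own; it is maximal because q separates Z from
    the rest. *)
Lemma end_block_of_separation (Z0 : {set T}) z0 q0 :
  connected_in e [set: T] -> z0 \in Z0 -> q0 \notin Z0 ->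
  boundary_in e [set: T] Z0 [set q0] ->
  exists (Z : {set T}) q, [/\ Z \subset Z0, Z != set0, q \notin Z, boundary_in e [set: T] Z [set q]
    & end_block e (q |: Z)].
Proof.
move=> conn z0Z q0Z bd0.
pose P (Z : {set T}) := [&& Z \subset Z0, Z != set0 &
  [exists q, (q \notin Z) && boundary_in e [set: T] Z [set q]]].
have P0 : P Z0.
  rewrite /P subxx; apply/and3P; split=> //; first by apply/set0Pn; exists z0.
  by apply/existsP; exists q0; rewrite q0Z.
case: (@arg_minnP _ Z0 P (fun Z : {set T} => #|Z|) P0) => Z PZ minZ.
have /and3P[sZ Zne /existsP[q /andP[qZ bdZ]]] := PZ.
have /set0Pn[z zZ] := Zne.
have minZ' (W : {set T}) w v : W \subset Z -> w \in W -> v \notin W ->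
    boundary_in e [set: T] W [set v] -> W = Z.
  move=> sW wW vW bdW; apply/eqP; rewrite eqEcard sW; apply: minZ.
  rewrite /P (subset_trans sW sZ) /=; apply/andP; split; first by apply/set0Pn; exists w.
  by apply/existsP; exists v; rewrite vW.
have nb u v : u \in Z -> e u v -> v \in q |: Z.
  move=> uZ euv; rewrite in_setU1.
  by have [->|->] := bd1P _ _ _ _ bdZ u v uZ (in_setT v) euv; rewrite ?eqxx ?orbT.
have no_closed (W : {set T}) w : W \subset Z -> w \in W -> closed_in e [set: T] W -> False.
  move=> sW wW /(closed_full conn wW) EW; case/negP: qZ.
  by apply: (subsetP sW); rewrite EW.
(* S is empty or one vertex of Z. The vertices not reached from q once S is deleted would be
   attached to S only. *)
have connect_q (S : {set T}) v : S \subset Z -> #|S| <= 1 -> v \in (q |: Z) :\: S ->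
    connect (induced e ((q |: Z) :\: S)) q v.
  move=> sSZ S1; set B := _ :\: S => vB.
  have qB : q \in B.
    by rewrite in_setD setU11 andbT; apply: contra qZ; apply: (subsetP sSZ).
  suff /reachP[_ [g [_ /set1P->]]] : v \in reach e B [set q] by [].
  apply/negPn/negP => vR; pose W := B :\: reach e B [set q].
  have vW : v \in W by rewrite in_setD vR.
  have sW : W \subset Z.
    apply/subsetP => u /setDP[uB uR]; have /setDP[/setU1P[Eu|//] _] := uB.
    by case/negP: uR; rewrite Eu; apply: reach_base; rewrite ?set11.
  have bdW u a : u \in W -> e u a -> a \in W \/ a \in S.
    move=> uW eua; have [aS|aS] := boolP (a \in S); [by right|left].
    have aB : a \in B by rewrite in_setD aS (nb u a (subsetP sW u uW) eua).
    rewrite in_setD aB andbT; apply/negP => aR; case/setDP: uW => uB /negP[].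
    by apply: (reach_closed aR uB); rewrite e_sym.
  have [S0|[c cS]] := set_0Vmem S.
    apply: (no_closed W v) => // u a uW _ eua.
    by have [//|] := bdW u a uW eua; rewrite S0 inE.
  have cW : c \notin W by apply/negP => /setDP[/setDP[_ /negP[]]].
  have EW : W = Z.
    apply: (minZ' W v c) => //; apply/bd1P => u a uW _ eua.
    have [|aS] := bdW u a uW eua; [by left|right].
    exact: (card_le1_eqP S1).
  by case/negP: cW; rewrite EW; apply: (subsetP sSZ).
have connect_Z u v : u \in Z -> v \in Z -> connect (induced e Z) u v.
  move=> uZ vZ; have : reach e Z [set u] = Z.
    apply: (minZ' _ u q).
    - exact: reach_sub.
    - by apply: reach_base; rewrite ?set11.
    - by apply/negP => /(subsetP (reach_sub _ _ _)); rewrite (negbTE qZ).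
    apply/bd1P => a b aR _ eab.
    have aZ := subsetP (reach_sub _ _ _) a aR.
    have /setU1P[->|bZ] := nb a b aZ eab; [by right|left].
    exact: reach_closed aR bZ eab.
  move=> ER; have : v \in reach e Z [set u] by rewrite ER.
  by case/reachP=> _ [g [_ /set1P->]].
exists Z, q; split=> //.
have BP : connected_in e (q |: Z) && [forall v, ~~ cut_vertex_in e (q |: Z) v].
  apply/andP; split.
    apply/andP; split; first by apply/set0Pn; exists q; rewrite setU11.
    have toq a : a \in q |: Z -> connect (induced e (q |: Z)) q a.
      by move=> aB; rewrite -[q |: Z]setD0; apply: connect_q; rewrite ?sub0set ?cards0 ?setD0.
    apply/forall_inP => u uB; apply/forall_inP => v vB.
    by apply: connect_trans (toq v vB); rewrite (induced_sym e_sym); apply: toq.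
  apply/forallP => c; apply/negP => /andP[cB /exists_inP[u uB]].
  case/exists_inP=> w wB /andP[_ /negP[]].
  case/setU1P: (cB) => [Ec|cZ].
    by rewrite Ec in uB wB *; rewrite setU1K // in uB wB *; apply: connect_Z.
  have sc : [set c] \subset Z by rewrite sub1set.
  have c1 : #|[set c]| <= 1 by rewrite cards1.
  apply: connect_trans (connect_q _ w sc c1 wB).
  by rewrite (induced_sym e_sym); apply: connect_q.
apply/andP; split.
  apply/maxsetP; split=> // A /andP[connA /forallP/(_ q) cutA] sBA.
  apply/eqP; rewrite eqEsubset sBA andbT; apply/subsetP => w wA.
  apply/negPn/negP => wB; case/negP: cutA.
  have zA : z \in A by apply: (subsetP sBA); rewrite setU1r.
  have wq : w != q by apply: contraNneq wB => ->; rewrite setU11.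
  have zq : z != q by apply: contraNneq qZ => <-.
  apply/andP; split; first by apply: (subsetP sBA); rewrite setU11.
  apply/exists_inP; exists z; first by rewrite in_setD1 zq.
  apply/exists_inP; exists w; first by rewrite in_setD1 wq.
  have /andP[_ /forall_inP/(_ z zA)/forall_inP/(_ w wA) ->] := connA.
  apply/negP => czw; case/negP: wB; rewrite in_setU1; apply/orP; right.
  apply: (closed_in_connect _ zZ czw) => u v uZ /setD1P[vq _] euv.
  by have /setU1P[E|//] := nb u v uZ euv; rewrite E eqxx in vq.
rewrite -(cards1 q); apply/subset_leq_card/subsetP => v.
rewrite in_set => /andP[vB /andP[_ /exists_inP[u uv /exists_inP[w wv /andP[_ ncon]]]]].
rewrite in_set1; apply/negPn/negP => vq.
have vZ : v \in Z by case/setU1P: vB => // E; rewrite E eqxx in vq.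
(* A cut vertex v in Z leaves a component without q. It lies in Z and has v as its only attachment,
   against minimality. *)
have [a [aV aR]] : exists a, a \in [set: T] :\ v /\ q \notin reach e ([set: T] :\ v) [set a].
  have [/reachP[_ [_ [_ /set1P-> cu]]]|] := boolP (q \in reach e ([set: T] :\ v) [set u]).
    exists w; split=> //; apply/negP => /reachP[_ [_ [_ /set1P-> cw]]].
    by case/negP: ncon; apply: connect_trans cu _; rewrite (induced_sym e_sym).
  by move=> qR; exists u.
set R := reach _ _ _ in aR; have aRR : a \in R by apply: reach_base; rewrite ?set11.
have vR : v \notin R.
  by apply/negP => /(subsetP (reach_sub _ _ _))/setD1P[]; rewrite eqxx.
have stepR s t : s \in R -> e s t -> t != v -> t \in R.
  by move=> sR est tv; apply: (reach_closed sR _ est); rewrite in_setD1 tv in_setT.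
have outZ s t : s \in R -> s \notin Z -> e s t -> t \notin Z.
  move=> sR sZ' est; apply/negP => tZ.
  have /setU1P[Es|] : s \in q |: Z by apply: (nb t) => //; rewrite e_sym.
    by rewrite -Es sR in aR.
  by rewrite (negbTE sZ').
have sR : R \subset Z.
  apply/negPn/negP => /subsetPn[b bR bZ].
  have : R :\: Z = [set: T].
    apply: (@closed_full _ b) => //; first by rewrite in_setD bZ.
    move=> s t /setDP[sR sZ'] _ est; have tZ := outZ s t sR sZ' est.
    rewrite in_setD tZ; apply: (stepR s) => //.
    by apply: contraNneq tZ => ->.
  by move/setP/(_ v); rewrite in_setD vZ in_setT.
have ER : R = Z.
  apply: (minZ' R a v) => //; apply/bd1P => s t sR' _ est.
  by have [->|tv] := eqVneq t v; [right|left; apply: stepR est tv].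
by rewrite ER vZ in vR.
Qed.

(** An end block cut off within Z can contain a root only as its attachment, which then separates it
    from the other root and is a cut vertex, against (R2). *)
Lemma no_separation x y (Z : {set T}) z q : rooted_2connected e x y -> x != y ->
  z \in Z -> x \notin Z -> y \notin Z -> q \notin Z -> ~~ boundary_in e [set: T] Z [set q].
Proof.
move=> [conn _ _ ends] xy zZ xZ yZ qZ; apply/negP => bdZ.
have [Z1 [q1 [sZ1 /set0Pn[z1 z1Z] qZ1 bdZ1 endB]]] :=
  end_block_of_separation conn zZ qZ bdZ.
have cut a b : a \in q1 |: Z1 -> a \notin Z -> b \notin Z -> a != b -> cut_vertex e a.
  move=> aB aZ bZ ab; have Ea : a = q1.
    by case/setU1P: aB => // /(subsetP sZ1); rewrite (negbTE aZ).
  rewrite {}Ea in aB aZ ab *; apply/andP; split=> //.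
  apply/exists_inP; exists z1.
    by rewrite in_setD1 in_setT andbT; apply: contraNneq qZ1 => <-.
  apply/exists_inP; exists b; first by rewrite in_setD1 in_setT eq_sym ab.
  have /andP[_ /forall_inP/(_ z1 (in_setT _))/forall_inP/(_ b (in_setT _)) ->] := conn.
  apply/negP => c1b; case/negP: bZ; apply: (subsetP sZ1).
  apply: (closed_in_connect _ z1Z c1b) => u v uZ /setD1P[vq _] euv.
  by have [//|E] := bd1P _ _ _ _ bdZ1 u v uZ (in_setT v) euv; rewrite E eqxx in vq.
case/orP: (ends _ endB) => /andP[aB /negP[]].
  exact: cut aB xZ yZ xy.
by apply: cut aB yZ xZ _; rewrite eq_sym.
Qed.

(** In the whole graph, a root joins the boundary of Z when Z meets its neighbourhood. Each set
    forbidden by [linked] thus has at most one boundary vertex there. *)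
Lemma linked_of_rooted x y : rooted_2connected e x y -> x != y ->
  linked e (~: [set x; y]) (nbr e x) (nbr e y).
Proof.
move=> h2 xy Z z /subsetP sZ zZ.
have xZ : x \notin Z by apply/negP => /sZ; rewrite !inE eqxx.
have yZ : y \notin Z by apply/negP => /sZ; rewrite !inE eqxx orbT.
have sep q : q \notin Z -> ~~ boundary_in e [set: T] Z [set q] by exact: (no_separation h2 xy zZ xZ yZ).
have lift (Q Q' : {set T}) : boundary_in e (~: [set x; y]) Z Q -> Q \subset Q' ->
    x \in Q' \/ [disjoint Z & nbr e x] -> y \in Q' \/ [disjoint Z & nbr e y] ->
    boundary_in e [set: T] Z Q'.
  move=> /bdP bdZ /subsetP sQ hx hy; apply/bdP => u v uZ _ euv.
  have [Ev|vx] := eqVneq v x.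
    case: hx => [|/disjP/(_ u uZ)]; first by rewrite Ev; right.
    by rewrite inE e_sym -Ev euv.
  have [Ev|vy] := eqVneq v y.
    case: hy => [|/disjP/(_ u uZ)]; first by rewrite Ev; right.
    by rewrite inE e_sym -Ev euv.
  have vA : v \in ~: [set x; y] by rewrite !inE negb_or vx.
  by have [|/sQ] := bdZ u v uZ vA euv; auto.
split.
- move=> q dx dy; apply/negP => bdZ; have [qZ|qZ] := boolP (q \in Z).
    (* If q lies in Z, nothing leaves Z at all, and x serves as the attachment. *)
    case/negP: (sep x xZ); apply: (lift set0); rewrite ?sub0set; auto.
    by apply: bd_set1 bdZ _; rewrite in_setD qZ.
  by case/negP: (sep q qZ); apply: lift bdZ _ _ _; auto.
- move=> dx; apply/negP => bdZ; case/negP: (sep y yZ).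
  by apply: lift bdZ _ _ _; rewrite ?sub0set ?set11; auto.
move=> dy; apply/negP => bdZ; case/negP: (sep x xZ).
by apply: lift bdZ _ _ _; rewrite ?sub0set ?set11; auto.
Qed.

Lemma degree_deg x y v : v != x -> v != y -> x != y ->
  degree e v = deg e (~: [set x; y]) (nbr e x) (nbr e y) v.
Proof.
move=> vx vy xy; rewrite /degree /deg (cardsD1 x) (cardsD1 y).
have -> : [set w | e v w] :\ x :\ y = ~: [set x; y] :&: nbr e v.
  by apply/setP => u; rewrite !inE negb_or andbA [(u != y) && _]andbC.
by rewrite !inE [y == x]eq_sym xy /= (e_sym v x) (e_sym v y); lia.
Qed.

Lemma path_of_trail x y n : x != y ->
  trail e (~: [set x; y]) (nbr e x) (nbr e y) n ->
  exists2 p, path_from_to e x y p & size p = n.+1.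
Proof.
move=> xy [h [t [-> p_t u_t sub /andP[]]]]; rewrite !inE => xh yl.
have out v : v \in h :: t -> (v != x) && (v != y).
  by move/sub; rewrite !inE negb_or.
exists (rcons (h :: t) y); last by rewrite size_rcons.
apply/and3P; split.
- by rewrite rcons_path /= xh p_t e_sym.
- by rewrite last_rcons.
rewrite cons_uniq mem_rcons in_cons negb_or xy rcons_uniq u_t andbT andTb.
by apply/andP; split; apply/negP => /out; rewrite eqxx ?andbF.
Qed.

End Blocks.

Theorem theorem3 (k : nat) (T : finType) (e : rel T) (x y : T)
    (hk : 0 < k) (hG : simple_graph e) (hxy : x != y)
    (h2 : rooted_2connected e x y)
    (hdeg : forall v : T, v != x -> v != y -> 2 * k - 1 <= degree e v) :
  exists P : seq (seq T),
    [/\ size P = k,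
        (forall p, p \in P -> path_from_to e x y p)
      & length_condition (map size P) \/ semi_length_condition (map size P)].
Proof.
have [e_sym e_irr] := hG.
have spr : spread (2 * k - 1) (trail e (~: [set x; y]) (nbr e x) (nbr e y)).
  (* The exceptional vertex is x, which is outside the vertex set, so every degree is controlled. *)
  apply: (solvable e_sym e_irr (leqnn _) (z := x)).
  - exact: linked_of_rooted.
  - move=> v; rewrite !inE negb_or => /andP[vx vy] _.
    by rewrite -(degree_deg e_sym) ?hdeg.
  have [_ T3 _ _] := h2.
  have : 0 < #|~: [set x; y]| by rewrite cardsCs setCK cards2 hxy subn_gt0.
  by case/card_gt0P=> v vA; exists v => //; move: vA; rewrite !inE negb_or => /andP[].
have [l [sz_l all_l cond]] := spread_lengths hk (@trail_gt0 _ _ _ _ _) spr.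
have [P [EP allP]] : exists P, map size P = l /\ forall p, p \in P -> path_from_to e x y p.
  elim: l all_l {sz_l cond} => [|m l IHl] all_l; first by exists [::].
  have [|P [EP allP]] := IHl; first by move=> a al; apply: all_l; rewrite inE al orbT.
  have [a /(path_of_trail e_sym hxy)[p pxy sz_p] Em] := all_l m (mem_head _ _).
  exists (p :: P); split; first by rewrite /= EP sz_p Em.
  by move=> q; rewrite inE => /orP[/eqP->|/allP].
exists P; split=> //; last by rewrite EP.
by rewrite -sz_l -EP size_map.
Qed.
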